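(* Let $E$ be a uniquely ergodic interval exchange transformation on $N$ intervals which is renormalizable with scaling ratio $\rho$. Let $\sigma$ be the primitive substitution associated with $E$, and let $\beta$ be the largest eigenvalue of the incidence matrix of $\sigma$. Then $\beta=\rho^{-1}$, and $\rho$ is a unit in the ring $\mathbb{Z}[\beta]$. The map $E$ is defined over $\mathbb{Q}(\rho)$, its rank $n$ is maximal and equal to the degree of $\rho$ over $\mathbb{Q}$, and: (i) if the drift vector of $E$ is non-zero, then $n$ is even and $n\le N$; (ii) if the drift vector of $E$ is zero, then $2n\le N$.
   Context: An interval exchange transformation (IET) on $N\ge 2$ intervals is a map $E$ of $\Omega=[0,1)$ obtained by partitioning $\Omega$ into $N$ consecutive half-open intervals $\Omega_1,\dots,\Omega_N$ of positive lengths $|\Omega_i|$ and rearranging them, preserving orientation, according to a permutation $\pi$ of $\{1,\dots,N\}$ that is irreducible, i.e. $\pi\{1,\dots,k\}=\{1,\dots,k\}$ only if $k=N$. Thus $E(x)=x+\tau_i$ for $x\in\Omega_i$, where the $\tau_i$ are the translation vectors. The module of $E$ is $\mathcal{M}=\{\sum_{i=1}^N m_i|\Omega_i| : m_i\in\mathbb{Z}\}$; it contains every $\tau_i$. The rank of $E$ is the rank $n$ of the free $\mathbb{Z}$-module $\mathcal{M}$. $E$ is defined over a field $K$ if all lengths $|\Omega_i|$ lie in $K$; the rank is maximal if it equals the degree over $\mathbb{Q}$ of the field generated by the lengths. $E$ is renormalizable with scaling ratio $\rho\in(0,1)$ if there is an interval $I=[a,a+\rho)\subset[0,1)$ such that the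 first-return (induced) map of $E$ on $I$ is conjugate to $E$ by the rescaling $r(x)=a+\rho x$; that is, the induced map is the IET $r\circ E\circ r^{-1}$ on the $N$ intervals $r(\Omega_i)$ of lengths $\rho|\Omega_i|$. The associated substitution $\sigma$ on the alphabet $\{1,\dots,N\}$ is defined as follows: $\sigma(i)$ is the word of indices of the intervals $\Omega_j$ successively visited by the $E$-orbit of the points of $r(\Omega_i)$, starting at time $0$ and up to (but not including) the first return to $I$ (this word is the same for all points of $r(\Omega_i)$). Its incidence matrix is the $N\times N$ matrix $M_\sigma$ whose $(j,i)$ entry is the number of occurrences of the letter $j$ in $\sigma(i)$. Drift vector: fix a $\mathbb{Z}$-basis of $\mathcal{M}$, and let $\phi:\mathcal{M}\to\mathbb{Z}^n$ be the isomorphism sending this basis to the canonical basis of $\mathbb{Z}^n$. Put $v_i=\phi(\tau_i)$. The drift vector is $\mathcal{S}=\sum_{i=1}^N|\Omega_i|\,v_i\in\mathbb{R}^n$. Whether it vanishes does not depend on the chosen basis. *)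

(* Defs.v *)
From HB Require Import structures.
From mathcomp Require Import all_boot all_order all_algebra perm.
From mathcomp Require Import complex.
From mathcomp Require Import all_classical all_reals all_analysis.

Set Implicit Arguments.
Unset Strict Implicit.
Unset Printing Implicit Defensive.

Import Order.TTheory GRing.Theory Num.Theory.

Local Open Scope classical_set_scope.
Local Open Scope ring_scope.

(* Letters are 0, ..., N-1 instead of 1, ..., N.  [iet_perm E i] is the position,
   after the exchange, of the [i]-th interval. *)
Record iet (R : realType) (N : nat) := Iet {
  len : 'I_N -> R ;
  iet_perm : 'S_N ;
  len_gt0 : forall i, 0 < len i ;
  len_sum1 : \sum_i len i = 1 ;
  iet_irreducible : forall k : nat, (0 < k <= N)%N ->
    iet_perm @: [set i : 'I_N | (i < k)%N]%SET = [set i : 'I_N | (i < k)%N]%SET ->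
    k = N }.

Section Iet.
Context {R : realType} {N : nat}.
Implicit Types (E : iet R N) (a rho x : R) (i j : 'I_N).

Definition endpoint E i : R := \sum_(j < N | (j < i)%N) len E j.

Definition Omega E i : interval R :=
  `[endpoint E i, endpoint E i + len E i[.

Definition translation E i : R :=
  \sum_(j < N | (iet_perm E j < iet_perm E i)%N) len E j - endpoint E i.

(* The intervals [Omega E i] partition [0,1); outside [0,1) the map is extended
   by the identity, which neither orbits in [0,1) nor measures carried by [0,1)
   can see. *)
Definition iet_map E x : R :=
  if [pick i | x \in Omega E i] is Some i then x + translation E i else x.

(* Borel probabilities on [0,1) are represented as Borel probabilities on the
   line giving mass 1 to [0,1). *)
Definition invariant_probability E (P : probability (measurableTypeR R) R) :=
  P (`[0, 1[%classic : set R) = 1%E /\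
  forall A : set (measurableTypeR R), measurable A ->
    P (iet_map E @^-1` A) = P A.

Definition uniquely_ergodic E : Prop :=
  exists2 P : probability (measurableTypeR R) R, invariant_probability E P &
    forall Q : probability (measurableTypeR R) R, invariant_probability E Q ->
      forall A : set (measurableTypeR R), measurable A -> Q A = P A.

Definition first_return E (I : set R) x (t : nat) : Prop :=
  [/\ (0 < t)%N, I (iter t (iet_map E) x) &
      forall s, (0 < s < t)%N -> ~ I (iter s (iet_map E) x)].

Definition renormalizable E a rho : Prop :=
  [/\ 0 < rho < 1, 0 <= a, a + rho <= 1 &
      forall x, 0 <= x < 1 ->
        exists2 t, first_return E `[a, a + rho[%classic (a + rho * x) t &
          iter t (iet_map E) (a + rho * x) = a + rho * iet_map E x].

Definition associated_substitution E a rho (sigma : 'I_N -> seq 'I_N) : Prop :=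
  forall i x, x \in Omega E i ->
    first_return E `[a, a + rho[%classic (a + rho * x) (size (sigma i)) /\
    forall k, (k < size (sigma i))%N ->
      iter k (iet_map E) (a + rho * x) \in Omega E (nth i (sigma i) k).

Definition iet_module E : set R :=
  [set x | exists m : 'I_N -> int, x = \sum_i (m i)%:~R * len E i].

End Iet.

Section Substitution.
Context {N : nat}.
Implicit Type sigma : 'I_N -> seq 'I_N.

Definition subst_word sigma (w : seq 'I_N) : seq 'I_N :=
  flatten [seq sigma i | i <- w].

Definition primitive_substitution sigma : Prop :=
  exists2 k, (0 < k)%N &
    forall i j : 'I_N, j \in iter k (subst_word sigma) [:: i].

Definition incidence sigma : 'M[int]_N :=
  \matrix_(j, i) (count_mem j (sigma i))%:Z.

End Substitution.

Definition largest_eigenvalue (R : realType) (N : nat) (A : 'M[int]_N)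
    (beta : R) : Prop :=
  eigenvalue (map_mx intr A : 'M[R]_N) beta /\
  forall z : complex R,
    eigenvalue (map_mx intr A : 'M[complex R]_N) z -> ComplexField.Normc.normc z <= beta.

Section Arithmetic.
Context {R : realType}.
Implicit Types (A M K : set R) (x : R) (n : nat).

Definition int_adjoin x : set R :=
  [set y | exists p : {poly int}, y = (map_poly intr p).[x]].

Definition is_unit_of A x : Prop :=
  A x /\ exists2 y, A y & x * y = 1.

(* The smallest subfield containing [A]. *)
Definition rat_adjoin A : set R :=
  [set x | forall F : {pred R}, GRing.divring_closed F ->
             (forall y, A y -> y \in F) -> x \in F].

(* Meant for a subfield [K], hence a rational vector space. *)
Definition rat_degree K n : Prop :=
  exists e : 'I_n -> R,
    [/\ forall k, K (e k),
        forall q : 'I_n -> rat,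
          \sum_k ratr (q k) * e k = 0 -> forall k, q k = 0 &
        forall x, K x -> exists q : 'I_n -> rat, x = \sum_k ratr (q k) * e k].

Definition algebraic_degree x n : Prop :=
  exists p : {poly rat},
    [/\ irreducible_poly p, root (map_poly ratr p) x & size p = n.+1].

Definition is_Zbasis M n (b : 'I_n -> R) : Prop :=
  [/\ forall k, M (b k),
      forall m : 'I_n -> int,
        \sum_k (m k)%:~R * b k = 0 -> forall k, m k = 0 &
      forall x, M x -> exists m : 'I_n -> int, x = \sum_k (m k)%:~R * b k].

(* For [b] a basis of [M], the restriction of [Zcoord b] to [M] is the
   isomorphism sending [b] to the canonical basis. *)
Definition Zcoord n (b : 'I_n -> R) x : 'rV[int]_n :=
  xget 0 [set v : 'rV[int]_n | x = \sum_k (v 0 k)%:~R * b k].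

Definition drift N (E : iet R N) n (b : 'I_n -> R) : 'rV[R]_n :=
  \sum_i len E i *: map_mx intr (Zcoord b (translation E i)).

End Arithmetic.

(* Main.v *)
(* Let M be the incidence matrix, lam the lengths, tau the translations.  The
   union of the floors of the towers over I is forward invariant, so unique
   ergodicity (against normalized Lebesgue measure) forces it to have full
   measure; counting floors in each Omega_j gives M lam = rho^-1 lam, and adding
   translations along a tower gives tau M = rho tau.  Positivity of lam makes
   rho^-1 the dominant eigenvalue, with a one-dimensional eigenspace, hence
   beta = rho^-1 and lam has entries in Q(rho); since rho is also an eigenvalue of
   M it is an algebraic integer, hence a unit of Z[beta].  The rational span of the
   lengths contains 1, is stable under rho^-1 and lies in Q(rho), so it is Q(rho).

   Let A be the matrix of multiplication by rho in the basis of the module; its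
   characteristic polynomial p is the minimal polynomial of rho.  The drift S
   satisfies S A = rho^-1 S, so S <> 0 makes rho^-1 a conjugate of rho and p
   reciprocal without the roots 1 and -1, whence n is even.  Conversely, if rho^-1
   is a root of p, an eigenvector of A for it pushes forward along the rows
   phi(tau_i) to a left eigenvector of M for rho^-1, whose pairing with lam is
   nonzero by Perron-Frobenius; this pairing is S applied to the eigenvector, so
   S <> 0.  Thus S = 0 makes the minimal polynomials of rho and rho^-1 coprime
   divisors of the characteristic polynomial of M. *)

Require Import Defs.
From HB Require Import structures.
From mathcomp Require Import all_boot all_order all_algebra perm.
From mathcomp Require Import complex.
From mathcomp Require Import fieldext.
From mathcomp Require Import all_classical all_reals all_analysis.
From mathcomp Require Import measurable_realfun.
Import Order.TTheory GRing.Theory Num.Theory.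
Local Open Scope classical_set_scope.
Local Open Scope ring_scope.

Set Implicit Arguments.
Unset Strict Implicit.
Unset Printing Implicit Defensive.

(** * Perron-Frobenius theory of a primitive substitution *)

Lemma rpred_det {F : comUnitRingType} (S : divringClosed F) n (A : 'M[F]_n) :
  (forall i j, A i j \in S) -> \det A \in S.
Proof.
move=> AS; apply: rpred_sum => s _; apply: rpredM.
  by apply: rpredX; rewrite rpredN rpred1.
exact: rpred_prod.
Qed.

Lemma rpred_invmx {F : fieldType} (S : divringClosed F) n (A : 'M[F]_n) :
  (forall i j, A i j \in S) -> A \in unitmx -> forall i j, invmx A i j \in S.
Proof.
move=> AS uA i j; rewrite /invmx uA !mxE rpredM ?rpredV ?rpred_det//.
rewrite rpredM//; first by apply: rpredX; rewrite rpredN rpred1.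
by apply: rpred_det => k l; rewrite !mxE.
Qed.

Section PerronFrobenius.
Context {R : realFieldType} {N : nat}.
Variables (sigma : 'I_N -> seq 'I_N) (c : 'I_N -> 'I_N -> R).
Hypothesis cE : forall j i, c j i = (count_mem j (sigma i))%:R.
Hypothesis sigma_prim : primitive_substitution sigma.

Let c_ge0 j i : 0 <= c j i. Proof. by rewrite cE ler0n. Qed.

Let c_gt0 j i : j \in sigma i -> 0 < c j i.
Proof. by move=> ji; rewrite cE ltr0n -has_count has_pred1. Qed.

Let occurs_iterS k i j : j \in iter k.+1 (subst_word sigma) [:: i] ->
  exists2 l, l \in iter k (subst_word sigma) [:: i] & j \in sigma l.
Proof.
by rewrite iterS => /flattenP[w /mapP[l hl ->] jw]; exists l.
Qed.

(** Primitivity joins [i] to [j] by a chain of [k] letters, each occurring in the image of the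
    previous one. A property inherited backwards along every link travels from [j] to [i];
    [prim_coconnected] is the forward version. *)
Let prim_connected (Z : pred 'I_N) j :
  (forall l m, m \in sigma l -> Z m -> Z l) -> Z j -> forall i, Z i.
Proof.
move=> Zstep; case: sigma_prim => k _ hk Zj i; move: (hk i j).
elim: k j Zj {hk} => [|k IHk] j Zj; first by rewrite inE => /eqP <-.
by case/occurs_iterS=> l hl jl; apply: (IHk l) => //; apply: Zstep jl Zj.
Qed.

Let prim_coconnected (Z : pred 'I_N) i :
  (forall l m, m \in sigma l -> Z l -> Z m) -> Z i -> forall j, Z j.
Proof.
move=> Zstep; case: sigma_prim => k _ hk Zi j; move: (hk i j).
elim: k j {hk} => [|k IHk] j; first by rewrite inE => /eqP ->.
by case/occurs_iterS=> l hl jl; apply: Zstep jl (IHk _ hl).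
Qed.

(** Where [w m = 0], the eigenvector equation is a vanishing sum of nonnegative terms, so [w] also
    vanishes at every [l] with [m] in [sigma l]. Primitivity spreads this to all letters. *)
Lemma perron_right_eq0 (b : R) (w : 'I_N -> R) j :
  (forall i, 0 <= w i) -> (forall j, \sum_i c j i * w i = b * w j) ->
  w j = 0 -> forall i, w i = 0.
Proof.
move=> w0 wE wj i; apply/eqP; move: i.
apply: (prim_connected (j := j) (Z := fun i => w i == 0)); last exact/eqP.
move=> l m ml /eqP wm; move: (wE m); rewrite wm mulr0 => /eqP.
rewrite psumr_eq0 => [/allP/(_ l)|i _]; last exact: mulr_ge0.
by rewrite mem_index_enum mulf_eq0 gt_eqF ?c_gt0// => /(_ isT).
Qed.

Lemma perron_left_eq0 (b : R) (w : 'I_N -> R) i :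
  (forall i, 0 <= w i) -> (forall i, \sum_j w j * c j i = b * w i) ->
  w i = 0 -> forall j, w j = 0.
Proof.
move=> w0 wE wi j; apply/eqP; move: j.
apply: (prim_coconnected (i := i) (Z := fun i => w i == 0)); last exact/eqP.
move=> l m ml /eqP wl; move: (wE l); rewrite wl mulr0 => /eqP.
rewrite psumr_eq0 => [/allP/(_ m)|j _]; last exact: mulr_ge0.
by rewrite mem_index_enum mulf_eq0 orbC gt_eqF ?c_gt0// => /(_ isT).
Qed.

Context (b : R) (x : 'I_N -> R).
Hypothesis x_gt0 : forall i, 0 < x i.
Hypothesis xE : forall j, \sum_i c j i * x i = b * x j.

(* Subtract from [w] the multiple of [x] at which a coordinate of the
   difference first vanishes. *)
Lemma perron_right_unique (w : 'I_N -> R) :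
  (forall j, \sum_i c j i * w i = b * w j) ->
  exists t, forall i, w i = t * x i.
Proof.
move=> wE; case: (pickP 'I_N) => [i0 _|none]; last by exists 0 => i; have := none i.
case: (Order.TotalTheory.arg_minP (fun i => w i / x i) (isT : xpredT i0)) => j _ minj.
exists (w j / x j) => i; apply/eqP; rewrite -subr_eq0; apply/eqP; move: i.
apply: (@perron_right_eq0 b _ j) => [i|i|].
- by rewrite subr_ge0 -ler_pdivlMr// minj.
- under eq_bigr do rewrite mulrBr mulrCA; rewrite sumrB -mulr_sumr wE xE.
  by rewrite mulrBr mulrCA.
- by rewrite divfK ?subrr// gt_eqF.
Qed.

(** The triangle inequality in the left eigenvector equation is weighted by [x]; exchanging the sums
    then lets the right eigenvector equation produce [b]. *)
Lemma perron_left_pair (b' : R) (w : 'I_N -> R) :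
  (forall i, \sum_j w j * c j i = b' * w i) ->
  \sum_i `|b'| * `|w i| * x i <= \sum_i b * `|w i| * x i.
Proof.
move=> wE; apply: (@le_trans _ _ (\sum_i (\sum_j `|w j| * c j i) * x i)).
  apply: ler_sum => i _; apply: ler_wpM2r; first exact: ltW.
  rewrite -normrM -wE (le_trans (ler_norm_sum _ _ _))//.
  by apply: ler_sum => j _; rewrite normrM [`|c _ _|]ger0_norm.
under eq_bigr do rewrite mulr_suml; rewrite exchange_big /=.
apply: ler_sum => j _; rewrite -mulrA mulrCA -xE mulr_sumr.
by under eq_bigr do rewrite -mulrA.
Qed.

Lemma perron_left_norm_le (b' : R) (w : 'I_N -> R) i :
  (forall i, \sum_j w j * c j i = b' * w i) -> w i != 0 -> `|b'| <= b.
Proof.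
move=> wE wi; have := perron_left_pair wE; under eq_bigr do rewrite -mulrA.
under [leRHS]eq_bigr do rewrite -mulrA.
rewrite -!mulr_sumr ler_pM2r// (bigD1 i)//= ltr_pwDl ?mulr_gt0 ?normr_gt0//.
by apply: sumr_ge0 => j _; rewrite mulr_ge0// ltW.
Qed.

(** Equality in the triangle inequality makes the absolute values of [w] a left eigenvector too.
    Adding or subtracting [w] then shows that [w] has constant sign, which is incompatible with
    orthogonality to the positive [x] unless [w] is zero. *)
Lemma perron_left_orthogonal (w : 'I_N -> R) : 0 <= b ->
  (forall i, \sum_j w j * c j i = b * w i) ->
  \sum_i w i * x i = 0 -> forall i, w i = 0.
Proof.
move=> b0 wE wx.
have absE i : \sum_j `|w j| * c j i = b * `|w i|.
  (* The defects of the triangle inequality are nonnegative and their sum weighted by [x] is zero,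
     so each of them vanishes. *)
  apply/eqP; rewrite eq_sym -subr_eq0 -oppr_eq0 opprB.
  have d_ge0 l : 0 <= (\sum_j `|w j| * c j l - b * `|w l|) * x l.
    apply: mulr_ge0; last exact: ltW.
    rewrite subr_ge0 -[X in X * _ <= _](ger0_norm b0) -normrM -wE.
    rewrite (le_trans (ler_norm_sum _ _ _))//.
    by apply: ler_sum => j _; rewrite normrM [`|c _ _|]ger0_norm.
  have : \sum_l (\sum_j `|w j| * c j l - b * `|w l|) * x l == 0.
    under eq_bigr do rewrite mulrBl mulr_suml; rewrite sumrB exchange_big/=.
    rewrite subr_eq0; apply/eqP; apply: eq_bigr => j _.
    by rewrite -mulrA mulrCA -xE mulr_sumr; under eq_bigr do rewrite -mulrA.
  rewrite psumr_eq0// => /allP/(_ i); rewrite mem_index_enum => /(_ isT).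
  by rewrite mulf_eq0 [x i == 0]gt_eqF// orbF.
(* The vector of the [|w i| + s * w i] is a nonnegative left eigenvector, so one zero coordinate
   annihilates it. *)
have sgn (s : R) : `|s| = 1 -> forall i, `|w i| + s * w i = 0 ->
    forall j, `|w j| + s * w j = 0.
  move=> s1 i; apply: perron_left_eq0 => [j|j].
    by rewrite -[`|w j|]mul1r -s1 -normrM -lerBlDr sub0r -normrN ler_norm.
  under eq_bigr do rewrite mulrDl -mulrA.
  by rewrite big_split/= absE -mulr_sumr wE mulrDr mulrCA.
have zero s : `|s| = 1 -> (forall j, `|w j| + s * w j = 0) -> forall i, w i = 0.
  move=> s1 sw; have abs0 : \sum_i `|w i| * x i == 0.
    suff -> : \sum_i `|w i| * x i = - s * \sum_i w i * x i by rewrite wx mulr0.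
    rewrite mulr_sumr; apply: eq_bigr => j _.
    by rewrite mulrA mulNr; congr (_ * _); apply/eqP; rewrite -addr_eq0 sw.
  move: abs0; rewrite psumr_eq0 => [/allP z i|j _]; last by rewrite mulr_ge0// ltW.
  have := z i; rewrite mem_index_enum => /(_ isT).
  by rewrite mulf_eq0 normr_eq0 [x i == 0]gt_eqF// orbF => /eqP.
(* The sign [s] is opposite to that of [w i], so that coordinate [i] is the required zero. *)
move=> i; have [w0|w0] := lerP 0 (w i).
  apply: (zero (-1)); first by rewrite normrN1.
  by apply: (sgn _ _ i); rewrite ?normrN1 ?ger0_norm// mulN1r subrr.
apply: (zero 1); first by rewrite normr1.
by apply: (sgn _ _ i); rewrite ?normr1 ?ltr0_norm// mul1r addNr.
Qed.

(* The eigenspace of [b] is a line, so the normalized [x] is the unique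
   solution of a linear system over [F]; normal equations make it square. *)
Lemma perron_right_mem (F : divringClosed R) : b \in F -> \sum_i x i = 1 ->
  forall i, x i \in F.
Proof.
move=> bF x1; pose C : 'M[R]_N := \matrix_(j, i) (c j i - b *+ (j == i)).
have CE (w : 'I_N -> R) j :
    (C *m \col_i w i) j 0 = \sum_i c j i * w i - b * w j.
  rewrite mxE (eq_bigr (fun i => c j i * w i - b * w i *+ (j == i))); last first.
    by move=> i _; rewrite !mxE mulrBl mulrnAl.
  rewrite sumrB; congr (_ - _); rewrite (bigD1 j)//= eqxx mulr1n big1 ?addr0// => i.
  by rewrite eq_sym => /negPf ->; rewrite mulr0n.
(* The first term encodes the eigenvector equation and the all-ones matrix encodes the
   normalization, so [x] solves [B x = 1] with [B] over [F]. *)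
pose B : 'M[R]_N := C^T *m C + const_mx 1.
have BxE : B *m (\col_i x i) = const_mx 1.
  have -> : B *m (\col_i x i) = C^T *m (C *m (\col_i x i)) + const_mx 1 *m (\col_i x i).
    by rewrite mulmxDl mulmxA.
  have -> : C *m (\col_i x i) = 0.
    by apply/matrixP => j k; rewrite ord1 CE xE subrr mxE.
  rewrite mulmx0 add0r; apply/matrixP => j k; rewrite !mxE -[RHS]x1.
  by apply: eq_bigr => i _; rewrite !mxE mul1r.
have uB : B \in unitmx.
  rewrite unitmxE unitfE; apply/negP => /det0P[v v0 vB].
  (* The quadratic form of [B] is a sum of squares. A kernel vector is thus an eigenvector, hence a
     multiple of [x], with coordinate sum 0; as [x] sums to 1, the multiple is 0. *)
  have Cv2 : \sum_j (C *m v^T) j 0 ^+ 2 + (\sum_i v 0 i) ^+ 2 = 0.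
    have vBv : (v *m B *m v^T) 0 0 = 0 by rewrite vB mul0mx mxE.
    rewrite -[RHS]vBv /B mulmxDr mulmxDl mxE; congr (_ + _).
      have -> : v *m (C^T *m C) *m v^T = (C *m v^T)^T *m (C *m v^T).
        by rewrite trmx_mul trmxK !mulmxA.
      by rewrite [RHS]mxE; apply: eq_bigr => j _; rewrite [in RHS]mxE expr2.
    rewrite mxE expr2 mulr_sumr; apply: eq_bigr => i _; rewrite !mxE; congr (_ * _).
    by apply: eq_bigr => j _; rewrite mxE mulr1.
  have /andP[/eqP Cv /eqP v1] :
      (\sum_j (C *m v^T) j 0 ^+ 2 == 0) && ((\sum_i v 0 i) ^+ 2 == 0).
    by rewrite -paddr_eq0 ?Cv2 ?sumr_ge0 ?sqr_ge0// => j _; rewrite sqr_ge0.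
  have [i|t vE] := @perron_right_unique (v 0).
    have /eqP := Cv; rewrite psumr_eq0 => [/allP/(_ i)|j _]; last exact: sqr_ge0.
    rewrite mem_index_enum sqrf_eq0 => /(_ isT).
    have -> : v^T = \col_i v 0 i by apply/colP => j; rewrite !mxE.
    by rewrite CE subr_eq0 => /eqP.
  move/eqP: v1; rewrite sqrf_eq0; under eq_bigr do rewrite vE.
  rewrite -mulr_sumr x1 mulr1 => /eqP t0.
  by case/eqP: v0; apply/rowP => i; rewrite vE t0 mul0r mxE.
have BF i j : B i j \in F.
  rewrite !mxE rpredD ?rpred1// rpred_sum// => k _; rewrite !mxE.
  by rewrite !cE rpredM// rpredB ?rpred_nat// rpredMn.
move=> i; have -> : x i = (invmx B *m const_mx 1 : 'cV_N) i 0.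
  by rewrite -BxE mulmxA mulVmx// mul1mx mxE.
rewrite mxE rpred_sum// => j _; rewrite mxE mulr1; exact: rpred_invmx.
Qed.

End PerronFrobenius.

(** * Rational polynomials, characteristic polynomials and rational spans *)

(** Divide the monic equation by [x ^+ d], where [d] is the degree of [p] minus one: what remains is
    [x] on one side and nonpositive powers of [x] on the other. *)
Lemma monic_int_root_adjoin_inv {F : fieldType} (p : {poly int}) (x : F) :
  p \is monic -> (1 < size p)%N -> x != 0 -> root (map_poly intr p) x ->
  exists q : {poly int}, x = (map_poly intr q).[x^-1].
Proof.
move=> p_mon sp x0; set d := (size p).-2 => px.
have sE : size p = d.+2 by rewrite /d; case: (size p) sp => [|[]].
exists (- \sum_(i < d.+1) p`_i *: 'X^(d - i)).
have xdE : x ^+ d.+1 = - \sum_(i < d.+1) (p`_i)%:~R * x ^+ i.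
  have sx : (size (map_poly intr p : {poly F}) <= d.+2)%N by rewrite -sE size_poly.
  move/rootP: px; rewrite (horner_coef_wide _ sx) big_ord_recr/=.
  move: p_mon; rewrite monicE lead_coefE sE/= => /eqP p1.
  under eq_bigr do rewrite coef_map/=; rewrite coef_map/= p1 mul1r addrC.
  by move/eqP; rewrite addr_eq0 => /eqP.
transitivity (x ^+ d.+1 * x^-1 ^+ d).
  by rewrite exprS -mulrA -exprMn divff// expr1n mulr1.
rewrite xdE rmorphN rmorph_sum/= hornerN horner_sum mulNr mulr_suml.
congr (- _); apply: eq_bigr => i _.
rewrite map_polyZ map_polyXn hornerZ hornerXn -mulrA; congr (_ * _).
have id : (i <= d)%N by rewrite -ltnS.
by rewrite -[X in _ * _ ^+ X = _](subnKC id) exprD mulrA -exprMn divff// expr1n mul1r.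
Qed.

Section RationalPolynomials.
Context {R : numFieldType}.
Implicit Types (x y : R) (p q : {poly rat}).

Definition rat_horner x : {pred R} :=
  [pred y | `[< exists q : {poly rat}, y = (map_poly ratr q).[x] >]].

Lemma rat_hornerP x y :
  reflect (exists q : {poly rat}, y = (map_poly ratr q).[x]) (y \in rat_horner x).
Proof. exact: asboolP. Qed.

Lemma rat_horner_id x : x \in rat_horner x.
Proof. by apply/rat_hornerP; exists 'X; rewrite map_polyX hornerX. Qed.

(** A nonzero [r(x)] is inverted by a Bezout relation. Since [p] may be reducible, it is first
    replaced by its largest divisor coprime to [r], which still vanishes at [x]. *)
Lemma rat_horner_divring x p : p != 0 -> root (map_poly ratr p) x ->
  GRing.divring_closed (rat_horner x).
Proof.
move=> p0 px; split=> [|_ _ /rat_hornerP[q ->] /rat_hornerP[r ->]|].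
- by apply/rat_hornerP; exists 1; rewrite rmorph1 hornerC.
- by apply/rat_hornerP; exists (q - r); rewrite rmorphB hornerD hornerN.
move=> _ _ /rat_hornerP[q ->] /rat_hornerP[r ->]; apply/rat_hornerP.
have [rx0|rx0] := eqVneq (map_poly ratr r).[x] 0.
  by exists 0; rewrite rx0 invr0 mulr0 rmorph0 horner0.
pose p' := gdcop r p.
have p'x : root (map_poly ratr p') x.
  by rewrite /p' gdcop_map root_gdco ?map_poly_eq0// px.
have /Bezout_eq1_coprimepP[[u v]/= uv] : coprimep p' r by exact: coprimep_gdco.
exists (q * v); rewrite rmorphM hornerM; congr (_ * _).
apply: (mulIf rx0); rewrite mulVf// -hornerM -rmorphM.
have /(congr1 (fun s => (map_poly ratr s).[x])) := uv.
by rewrite rmorphD !rmorphM/= hornerD !hornerM (rootP p'x) mulr0 add0r rmorph1 hornerC.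
Qed.

Lemma irreducible_root_dvdp x p q : irreducible_poly p ->
  root (map_poly ratr p) x -> root (map_poly ratr q) x -> p %| q.
Proof.
move=> irr_p px qx; have := irreducible_poly_coprime q irr_p.
case: (p %| q) => //= /Bezout_eq1_coprimepP[[u v]/=].
move=> /(congr1 (fun s => (map_poly ratr s).[x])).
rewrite rmorphD !rmorphM/= hornerD !hornerM (rootP px) (rootP qx) !mulr0 addr0.
by rewrite rmorph1 hornerC => /eqP; rewrite eq_sym oner_eq0.
Qed.

Lemma irreducible_horner_neq0 x p (a : rat) : irreducible_poly p ->
  root (map_poly ratr p) x -> x != ratr a -> p.[a] != 0.
Proof.
move=> irr_p px; apply: contra; rewrite -rootE -dvdp_XsubCl.
move=> /(apply_irredp irr_p); rewrite size_XsubC => /(_ isT) eqp.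
have : root (map_poly ratr ('X - a%:P)) x.
  by move: eqp; rewrite -(eqp_map (@ratr R)) => /eqp_root ->.
by rewrite rmorphB/= map_polyX map_polyC root_XsubC.
Qed.

Lemma irreducible_dvdp_eqp x p q : irreducible_poly p -> p \is monic ->
  q \is monic -> size q = size p -> root (map_poly ratr p) x ->
  root (map_poly ratr q) x -> q = p.
Proof.
move=> irr_p p_mon q_mon sqp px qx; apply/eqP.
rewrite -eqp_monic// eqp_sym -dvdp_size_eqp ?sqp//.
exact: irreducible_root_dvdp px qx.
Qed.

End RationalPolynomials.

(** * Eigenvectors and roots of characteristic polynomials *)

Lemma root_char_poly_left {F : fieldType} n (A : 'M[F]_n) (x : F) :
  root (char_poly A) x <->
  exists2 u : 'I_n -> F, exists k, u k != 0 &
    forall l, \sum_k u k * A k l = x * u l.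
Proof.
rewrite -eigenvalue_root_char; split=> [/eigenvalueP[v vA v0]|[u [k uk] uA]].
  exists (v 0) => [|l]; last by have /rowP/(_ l) := vA; rewrite !mxE.
  by have /rV0Pn[k vk] := v0; exists k.
apply/eigenvalueP; exists (\row_k u k).
  by apply/rowP => l; rewrite !mxE -uA; apply: eq_bigr => j _; rewrite mxE.
by apply/rV0Pn; exists k; rewrite mxE.
Qed.

Lemma char_poly_trmx {F : comNzRingType} n (A : 'M[F]_n) :
  char_poly A^T = char_poly A.
Proof.
rewrite /char_poly -det_tr; congr (\det _).
by apply/matrixP => i j; rewrite !mxE eq_sym.
Qed.

Lemma root_char_poly_right {F : fieldType} n (A : 'M[F]_n) (x : F) :
  root (char_poly A) x <->
  exists2 u : 'I_n -> F, exists k, u k != 0 &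
    forall k, \sum_l A k l * u l = x * u k.
Proof.
rewrite -char_poly_trmx root_char_poly_left; split=> -[u u0 uA]; exists u => // k.
  by rewrite -uA; apply: eq_bigr => l _; rewrite mxE mulrC.
by rewrite -uA; apply: eq_bigr => l _; rewrite mxE mulrC.
Qed.

Lemma horner_char_poly {F : comNzRingType} n (A : 'M[F]_n) (x : F) :
  (char_poly A).[x] = \det (x%:M - A).
Proof.
rewrite -horner_evalE -det_map_mx; congr (\det _); apply/matrixP => i j.
by rewrite !mxE/= horner_evalE hornerD hornerN hornerMn hornerX hornerC.
Qed.

(* As [(1 - B) A = - (1 - A)] and [(-1 - B) A = -1 - A], taking determinants
   gives [\det A = (-1)^n] and [\det A = 1]. *)
Lemma char_poly_inv_even {F : numFieldType} n (A B : 'M[F]_n) :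
  B *m A = 1%:M -> char_poly A = char_poly B ->
  (char_poly A).[1] != 0 -> (char_poly A).[-1] != 0 -> ~~ odd n.
Proof.
move=> BA AB; rewrite !horner_char_poly => A1 AN1.
have dA : (-1) ^+ n = \det A.
  apply: (mulIf A1); rewrite -[X in _ = _ * X]horner_char_poly AB horner_char_poly.
  by rewrite -detZ mulrC -det_mulmx mulmxBl mul1mx BA scaleN1r opprB.
have dA1 : 1 = \det A.
  apply: (mulIf AN1); rewrite -[X in _ = _ * X]horner_char_poly AB horner_char_poly.
  rewrite mul1r mulrC -det_mulmx mulmxBl BA; congr (\det _).
  by rewrite rmorphN/= mulNmx mul1mx addrC.
move: dA; rewrite -dA1 -signr_odd; case: (odd n) => //= /eqP.
by rewrite expr1 eq_sym -subr_eq0 opprK -mulr2n pnatr_eq0.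
Qed.

(** * Linear independence over the rationals and minimal polynomials *)

Section RationalBasis.
Context {R : numFieldType} {n : nat} (e : 'I_n -> R).

Definition rat_free := forall q : 'I_n -> rat,
  \sum_k ratr (q k) * e k = 0 -> forall k, q k = 0.

Lemma int_free_rat_free :
  (forall m : 'I_n -> int, \sum_k (m k)%:~R * e k = 0 -> forall k, m k = 0) ->
  rat_free.
Proof.
move=> efree q q0; pose d := \prod_k denq (q k).
pose m k := numq (q k) * \prod_(l | l != k) denq (q l).
have mE k : ratr (q k) * d%:~R = (m k)%:~R :> R.
  rewrite /d (bigD1 k)//= !intrM mulrA; congr (_ * _).
  by rewrite -[in RHS]ratr_int numqE rmorphM/= ratr_int.
have m0 : \sum_k (m k)%:~R * e k = 0.
  rewrite (eq_bigr (fun k => d%:~R * (ratr (q k) * e k))) => [|k _].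
    by rewrite -mulr_sumr q0 mulr0.
  by rewrite -mE mulrAC mulrC.
move=> k; have := efree _ m0 k; rewrite /m => /eqP; rewrite mulf_eq0 numq_eq0.
by case/orP=> [/eqP//|/prodf_eq0[l _]]; rewrite denq_eq0.
Qed.

Hypothesis efree : rat_free.

Lemma rat_free_eq (q r : 'I_n -> rat) :
  \sum_k ratr (q k) * e k = \sum_k ratr (r k) * e k -> q =1 r.
Proof.
move=> qr k; apply/eqP; rewrite -subr_eq0; apply/eqP; move: k.
apply: efree; apply/eqP; rewrite (eq_bigr _ (fun k _ => congr1 (fun z => z * e k)
  (rmorphB _ _ _))); under eq_bigr do rewrite mulrBl.
by rewrite sumrB qr subrr.
Qed.

(** Reduction modulo [q] writes each [e k] in the powers of [x] below the degree of [q]. With more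
    vectors than powers, a left kernel vector of the coefficient matrix would be a rational
    relation. *)
Lemma rat_horner_free_size x (q : {poly rat}) :
  (forall k, e k \in rat_horner x) -> q != 0 -> root (map_poly ratr q) x ->
  (n < size q)%N.
Proof.
move=> ex q0 qx; rewrite ltnNge; apply/negP => sqn.
have /choice[r rE] k : exists r : {poly rat}, e k = (map_poly ratr r).[x].
  exact/rat_hornerP.
pose m := (size q).-1; have mn : (m < n)%N by rewrite prednK ?size_poly_gt0.
pose C : 'M[rat]_(n, m) := \matrix_(k, l) (r k %% q)`_l.
have eE k : e k = \sum_l ratr (C k l) * x ^+ l.
  rewrite rE {1}(divp_eq (r k) q) rmorphD rmorphM/= hornerD hornerM (rootP qx).
  rewrite mulr0 add0r (@horner_coef_wide _ m); last first.
    by rewrite size_map_poly -ltnS prednK ?size_poly_gt0// ltn_modp.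
  by apply: eq_bigr => l _; rewrite coef_map mxE.
have /rowV0Pn[u /sub_kermxP uC /rV0Pn[k]] : kermx C != 0.
  rewrite kermx_eq0 /row_free neq_ltn (leq_ltn_trans (rank_leq_col _))//.
apply/negP; rewrite negbK; apply/eqP; move: k.
apply: efree; under eq_bigr do rewrite eE mulr_sumr; rewrite exchange_big/=.
rewrite big1// => l _; have /rowP/(_ l) := uC; rewrite !mxE.
move=> /(congr1 (@ratr R)); rewrite rmorph0 rmorph_sum/= => uCl.
under eq_bigr do rewrite mulrA; rewrite -mulr_suml.
under eq_bigr do rewrite -rmorphM; by rewrite uCl mul0r.
Qed.

(** The family [e] is a right eigenvector of [A] for [x], and the preceding bound forbids
    annihilators of [x] of degree below [n]; an annihilator of least degree is irreducible. *)
Lemma rat_basis_char_poly x (A : 'M[rat]_n) : (0 < n)%N ->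
  (forall k, e k \in rat_horner x) ->
  (forall k, x * e k = \sum_l ratr (A k l) * e l) ->
  irreducible_poly (char_poly A) /\ root (map_poly ratr (char_poly A)) x.
Proof.
move=> n0 ex xE; have rx : root (map_poly ratr (char_poly A)) x.
  rewrite map_char_poly; apply/root_char_poly_right; exists e => [|k].
    exists (Ordinal n0); apply/eqP => e0.
    have := efree (q := fun k => (k == Ordinal n0)%:R).
    rewrite big1 => [/(_ erefl (Ordinal n0))|k _]; first by rewrite eqxx.
    by case: eqP => [->|_]; rewrite ?e0 ?mulr0// rmorph0 mul0r.
  by rewrite xE; apply: eq_bigr => l _; rewrite mxE.
split=> //; apply/(subfx_irreducibleP rx).
  by rewrite monic_neq0 ?char_poly_monic.
by move=> q qx q0; rewrite size_char_poly; exact: rat_horner_free_size qx.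
Qed.

End RationalBasis.

Section RationalSpan.
Context {R : numFieldType} {m : nat} (f : 'I_m -> R).

Definition rat_span (y : R) := exists h : 'I_m -> rat, y = \sum_i ratr (h i) * f i.

Lemma rat_span_sum (I : finType) (c : I -> rat) (y : I -> R) :
  (forall i, rat_span (y i)) -> rat_span (\sum_i ratr (c i) * y i).
Proof.
move=> /choice[h hE]; exists (fun j => \sum_i c i * h i j).
under eq_bigr do rewrite hE mulr_sumr; rewrite exchange_big/=.
apply: eq_bigr => j _; rewrite rmorph_sum mulr_suml.
by apply: eq_bigr => i _; rewrite rmorphM mulrA.
Qed.

Lemma rat_spanD y z : rat_span y -> rat_span z -> rat_span (y + z).
Proof.
move=> [h ->] [k ->]; exists (fun i => h i + k i).
by rewrite -big_split; apply: eq_bigr => i _; rewrite rmorphD mulrDl.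
Qed.

Lemma rat_spanZ (c : rat) y : rat_span y -> rat_span (ratr c * y).
Proof.
move=> [h ->]; exists (fun i => c * h i).
by rewrite mulr_sumr; apply: eq_bigr => i _; rewrite rmorphM mulrA.
Qed.

Lemma rat_span0 : rat_span 0.
Proof. by exists (fun=> 0); rewrite big1// => i _; rewrite rmorph0 mul0r. Qed.

(** Induction along Horner's scheme. It serves for the lengths, stable under [rho^-1], and for the
    translations, stable under [rho]. *)
Lemma rat_spanM_horner x y (q : {poly rat}) :
  (forall i, rat_span (x * f i)) -> rat_span y ->
  rat_span ((map_poly ratr q).[x] * y).
Proof.
move=> xf yf; elim/poly_ind: q => [|q c IHq].
  by rewrite rmorph0 horner0 mul0r; exact: rat_span0.
rewrite rmorphD rmorphM/= map_polyX map_polyC/= hornerD hornerM hornerX hornerC.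
rewrite mulrDl; apply: rat_spanD; last exact: rat_spanZ.
case: IHq => h; rewrite mulrAC => ->; rewrite mulr_suml.
by under eq_bigr do rewrite -mulrA [f _ * x]mulrC; exact: rat_span_sum.
Qed.

End RationalSpan.

Lemma rat_horner_sub {R : numFieldType} (S : divringClosed R) x :
  x \in S -> {subset rat_horner x <= S}.
Proof.
move=> xS _ /rat_hornerP[q ->]; rewrite horner_coef rpred_sum// => i _.
rewrite rpredM ?rpredX// coef_map /= rpred_div ?rpred_int//.
Qed.

(** * Arithmetic of the module *)

Lemma ratr_sum {R : numFieldType} (I : finType) (f : I -> rat) :
  ratr (\sum_i f i) = \sum_i ratr (f i) :> R.
Proof. exact: rmorph_sum. Qed.

Lemma ratr_intM {R : numFieldType} (z : int) (q : rat) :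
  ratr (z%:~R * q) = z%:~R * ratr q :> R.
Proof. by rewrite rmorphM; congr (_ * _); exact: ratr_int. Qed.

Lemma ratr_Mint {R : numFieldType} (z : int) (q : rat) :
  ratr (q * z%:~R) = ratr q * z%:~R :> R.
Proof. by rewrite mulrC ratr_intM mulrC. Qed.

Section RenormalizationArithmetic.
Context {R : realFieldType} {N : nat} (sigma : 'I_N -> seq 'I_N).
Hypothesis sigma_prim : primitive_substitution sigma.
Let c (j i : 'I_N) : R := (count_mem j (sigma i))%:R.
Let cE j i : c j i = (count_mem j (sigma i))%:R. Proof. by []. Qed.
Context (lam tau : 'I_N -> R) (rho : R).
Hypothesis lam_gt0 : forall i, 0 < lam i.
Hypothesis lam_sum1 : \sum_i lam i = 1.
Hypothesis lamE : forall j, \sum_i c j i * lam i = rho^-1 * lam j.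
Hypothesis tauE : forall i, \sum_j tau j * c j i = rho * tau i.
Context (i0 : 'I_N).
Hypothesis tau_neq0 : tau i0 != 0.
Hypothesis rho01 : 0 < rho < 1.

Let rho_gt0 : 0 < rho. Proof. by case/andP: rho01. Qed.
Let rho_neq0 : rho != 0. Proof. by rewrite gt_eqF. Qed.
Let M : 'M[rat]_N := map_mx intr (incidence sigma).
Let ratrM j i : ratr (M j i) = c j i.
Proof. by rewrite !mxE rmorph_int cE pmulrn. Qed.

Let rootM (x : R) :
  root (map_poly intr (char_poly (incidence sigma))) x =
  root (map_poly ratr (char_poly M)) x.
Proof.
congr root; rewrite !map_char_poly; congr char_poly.
by apply/matrixP => i j; rewrite [RHS]mxE/= ratrM !mxE cE pmulrn.
Qed.

Lemma root_incidence_scaling :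
  root (map_poly intr (char_poly (incidence sigma))) rho.
Proof.
rewrite map_char_poly; apply/root_char_poly_left; exists tau => [|i].
  by exists i0.
by rewrite -tauE; apply: eq_bigr => j _; rewrite !mxE cE pmulrn.
Qed.

Lemma root_incidence_expansion :
  root (map_poly intr (char_poly (incidence sigma))) rho^-1.
Proof.
rewrite map_char_poly; apply/root_char_poly_right; exists lam => [|j].
  by exists i0; rewrite gt_eqF.
by rewrite -lamE; apply: eq_bigr => i _; rewrite !mxE cE pmulrn.
Qed.

Lemma scaling_adjoin : exists q : {poly int}, rho = (map_poly intr q).[rho^-1].
Proof.
apply: (@monic_int_root_adjoin_inv _ (char_poly (incidence sigma))) => //.
- exact: char_poly_monic.
- by rewrite size_char_poly ltnS (leq_ltn_trans _ (ltn_ord i0)).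
- exact: root_incidence_scaling.
Qed.

Lemma len_mem (F : divringClosed R) : rho \in F -> forall i, lam i \in F.
Proof.
move=> rF; apply: (perron_right_mem cE sigma_prim lam_gt0 lamE) => //.
by rewrite rpredV.
Qed.

Let chi_neq0 : char_poly M != 0. Proof. exact/monic_neq0/char_poly_monic. Qed.

(** [Qrho] and [Qbeta] are one field, presented by polynomials in [rho] and in [rho^-1]. The second
    form is the one that fits [lamE], which gives stability under [rho^-1]. *)
Let Qrho : divringClosed R := HB.pack (rat_horner rho)
  (GRing.isDivringClosed.Build _ (rat_horner rho)
    (rat_horner_divring chi_neq0
      (etrans (esym (rootM rho)) root_incidence_scaling))).

Let Qbeta : divringClosed R := HB.pack (rat_horner rho^-1)
  (GRing.isDivringClosed.Build _ (rat_horner rho^-1)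
    (rat_horner_divring chi_neq0
      (etrans (esym (rootM rho^-1)) root_incidence_expansion))).

Let rho_Qrho : rho \in Qrho. Proof. exact: rat_horner_id. Qed.
Let rho_Qbeta : rho \in Qbeta.
Proof. by rewrite -[rho]invrK rpredV; exact: rat_horner_id. Qed.

Context {n : nat} (b : 'I_n -> R).
Hypothesis b_free : rat_free b.
Context (m : 'I_n -> 'I_N -> int) (L v : 'I_N -> 'I_n -> int).
Hypothesis bE : forall k, b k = \sum_i (m k i)%:~R * lam i.
Hypothesis lamb : forall i, lam i = \sum_k (L i k)%:~R * b k.
Hypothesis taub : forall i, tau i = \sum_k (v i k)%:~R * b k.

Lemma basis_mem (F : divringClosed R) : rho \in F -> forall k, b k \in F.
Proof.
by move=> rF k; rewrite bE rpred_sum// => i _; rewrite rpredM ?rpred_int ?len_mem.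
Qed.

Lemma scaling_field_span y : y \in rat_horner rho -> rat_span b y.
Proof.
move=> /(rat_horner_sub rho_Qbeta)/rat_hornerP[q ->].
have lam_span i : rat_span lam (rho^-1 * lam i).
  by exists (M i) => //; rewrite -lamE; under [RHS]eq_bigr do rewrite ratrM.
have one_span : rat_span lam 1.
  by exists (fun=> 1); rewrite -lam_sum1; under [RHS]eq_bigr do rewrite rmorph1 mul1r.
have [h hE] := rat_spanM_horner q lam_span one_span.
rewrite -[_.[_]]mulr1 hE; apply: rat_span_sum => i.
by exists (fun k => (L i k)%:~R); rewrite lamb; under [RHS]eq_bigr do rewrite ratr_int.
Qed.

Lemma basis_gt0 : (0 < n)%N.
Proof.
have [h] := scaling_field_span (rpred1 Qrho).
by case: n b h => // b' h; rewrite big_ord0 => /eqP; rewrite oner_eq0.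
Qed.

Let exists_A : exists A : 'M[rat]_n, forall k, rho * b k = \sum_l ratr (A k l) * b l.
Proof.
have /choice[h hE] : forall k, rat_span b (rho * b k).
  by move=> k; apply/scaling_field_span/(@rpredM _ Qrho) => //; exact: basis_mem.
by exists (\matrix_(k, l) h k l) => k; rewrite hE; under [RHS]eq_bigr do rewrite mxE.
Qed.

Let exists_B : exists B : 'M[rat]_n, forall k, rho^-1 * b k = \sum_l ratr (B k l) * b l.
Proof.
have /choice[h hE] : forall k, rat_span b (rho^-1 * b k).
  move=> k; apply/scaling_field_span/(@rpredM _ Qrho); last exact: basis_mem.
  by rewrite rpredV.
by exists (\matrix_(k, l) h k l) => k; rewrite hE; under [RHS]eq_bigr do rewrite mxE.
Qed.

(** Both sides are the coordinates of [rho * tau i] in [b], computed through [A] and through [tauE].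
    Hence the matrix with rows [v i] intertwines [A] with the transpose of [M]. *)
Let vA (A : 'M[rat]_n) :
  (forall k, rho * b k = \sum_l ratr (A k l) * b l) ->
  forall i l, \sum_k (v i k)%:~R * A k l = \sum_j M j i * (v j l)%:~R.
Proof.
move=> AE i; apply: (rat_free_eq b_free); transitivity (rho * tau i).
  rewrite taub mulr_sumr; under [RHS]eq_bigr do rewrite mulrCA AE mulr_sumr.
  rewrite exchange_big/=; apply: eq_bigr => l _; rewrite ratr_sum mulr_suml.
  by apply: eq_bigr => k _; rewrite ratr_intM -mulrA.
rewrite -tauE; under eq_bigr do rewrite taub mulr_suml.
rewrite exchange_big/=; apply: eq_bigr => l _; rewrite ratr_sum mulr_suml.
by apply: eq_bigr => j _; rewrite ratr_Mint ratrM mulrAC [c j i * _]mulrC.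
Qed.

(** The rational span of the translations is stable under [rho] and contains [tau i0], hence every
    [b k], since [b k / tau i0] is a polynomial in [rho]. The left inverse makes [v] injective on
    column vectors. *)
Let v_linv : exists h : 'I_n -> 'I_N -> rat,
  forall k l, \sum_i h k i * (v i l)%:~R = (k == l)%:R.
Proof.
have tau_Q i : tau i \in Qrho.
  by rewrite taub rpred_sum// => k _; rewrite rpredM ?rpred_int ?basis_mem.
have tau_span i : rat_span tau (rho * tau i).
  by exists (M^~ i); rewrite -tauE; apply: eq_bigr => j _; rewrite ratrM mulrC.
have tau0_span : rat_span tau (tau i0).
  exists (fun i => (i == i0)%:R); rewrite (bigD1 i0)//= eqxx rmorph1 mul1r big1 ?addr0//.
  by move=> i /negPf ->; rewrite rmorph0 mul0r.
have /choice[h hE] : forall k, rat_span tau (b k).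
  move=> k; have /rat_hornerP[q qE] : b k / tau i0 \in Qrho.
    by rewrite rpred_div ?basis_mem.
  by rewrite -(divfK tau_neq0 (b k)) qE; apply: rat_spanM_horner.
exists h => k; apply: (rat_free_eq b_free); transitivity (b k).
  rewrite hE; under [RHS]eq_bigr do rewrite taub mulr_sumr.
  rewrite exchange_big/=; apply: eq_bigr => l _; rewrite ratr_sum mulr_suml.
  by apply: eq_bigr => i _; rewrite ratr_Mint -mulrA.
rewrite (bigD1 k)//= eqxx rmorph1 mul1r big1 ?addr0// => l.
by rewrite eq_sym => /negPf ->; rewrite rmorph0 mul0r.
Qed.

(** This is the drift vector in the coordinates of [b]. *)
Let S l := \sum_i lam i * (v i l)%:~R.

(** As a row, [S] is [lam] times the matrix [v]; [vA] exchanges [A] for the transpose of [M], and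
    [lamE] evaluates the latter on [lam]. *)
Let S_left (A : 'M[rat]_n) : (forall k, rho * b k = \sum_l ratr (A k l) * b l) ->
  forall l, \sum_k S k * ratr (A k l) = rho^-1 * S l.
Proof.
move=> AE l; rewrite /S; under eq_bigr do rewrite mulr_suml.
rewrite exchange_big/=.
transitivity (\sum_i lam i * \sum_j c j i * (v j l)%:~R).
  apply: eq_bigr => i _; under eq_bigr do rewrite -mulrA; rewrite -mulr_sumr.
  congr (_ * _); have /(congr1 (@ratr R)) := vA AE i l; rewrite !ratr_sum => vAE.
  under eq_bigr do rewrite -ratr_intM; rewrite vAE.
  by apply: eq_bigr => j _; rewrite ratr_Mint ratrM.
under [LHS]eq_bigr do rewrite mulr_sumr; rewrite exchange_big/= mulr_sumr.
apply: eq_bigr => j _; rewrite mulrA -lamE mulr_suml.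
by apply: eq_bigr => i _; rewrite mulrCA mulrA.
Qed.

Lemma scaling_min_poly : exists p : {poly rat},
  [/\ irreducible_poly p, root (map_poly ratr p) rho, size p = n.+1 &
    ((exists l, S l != 0) <-> root (map_poly ratr p) rho^-1) /\
    (root (map_poly ratr p) rho^-1 -> ~~ odd n)].
Proof.
have [A AE] := exists_A; have [B BE] := exists_B.
have [irrA rA] := rat_basis_char_poly b_free basis_gt0 (basis_mem rho_Qrho) AE.
have [irrB rB] := rat_basis_char_poly b_free basis_gt0 (basis_mem rho_Qbeta) BE.
exists (char_poly A); split; rewrite ?size_char_poly//; split; first split.
- move=> S0; rewrite map_char_poly; apply/root_char_poly_left; exists S => // l.
  by rewrite -(S_left AE); apply: eq_bigr => k _; rewrite mxE.
- rewrite map_char_poly => /root_char_poly_right[u [k uk] uA].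
  apply/not_existsP => S0; have {}S0 l : S l = 0.
    by apply/eqP; apply: contra_notT (S0 l).
  (* By [vA], [w] is a left eigenvector of [M] for [rho^-1]. Its pairing with [lam] equals that of
     [S] with [u], which is 0. *)
  pose w i := \sum_l (v i l)%:~R * u l.
  have w0 : forall i, w i = 0.
    apply: (perron_left_orthogonal cE sigma_prim lam_gt0 lamE).
    + by rewrite invr_ge0 ltW.
    + move=> i; rewrite /w; under eq_bigr do rewrite mulr_suml.
      rewrite exchange_big/= mulr_sumr.
      transitivity (\sum_l (\sum_j c j i * (v j l)%:~R) * u l).
        apply: eq_bigr => l _; rewrite mulr_suml; apply: eq_bigr => j _.
        by rewrite mulrAC [_ * c j i]mulrC.
      transitivity (\sum_l (\sum_k0 (v i k0)%:~R * ratr (A k0 l)) * u l).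
        apply: eq_bigr => l _; congr (_ * _).
        have /(congr1 (@ratr R)) := vA AE i l; rewrite !ratr_sum => vAE.
        transitivity (\sum_j ratr (M j i * (v j l)%:~R) : R).
          by apply: eq_bigr => j _; rewrite ratr_Mint ratrM.
        by rewrite -vAE; apply: eq_bigr => j _; rewrite ratr_intM.
      under eq_bigr do rewrite mulr_suml; rewrite exchange_big/=.
      apply: eq_bigr => k0 _; rewrite mulrCA -uA mulr_sumr.
      by apply: eq_bigr => l _; rewrite -mulrA mxE.
    + transitivity (\sum_l S l * u l); last by rewrite big1// => l _; rewrite S0 mul0r.
      rewrite /w /S; under eq_bigr do rewrite mulr_suml.
      rewrite exchange_big/=; apply: eq_bigr => l _; rewrite mulr_suml.
      by apply: eq_bigr => i _; rewrite mulrC mulrA.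
  (* The left inverse [h] recovers [u k] from [w = 0], against the choice of [k]. *)
  have [h hE] := v_linv; case/eqP: uk.
  transitivity (\sum_i ratr (h k i) * w i); last first.
    by rewrite big1// => i _; rewrite w0 mulr0.
  rewrite /w; under eq_bigr do rewrite mulr_sumr; rewrite exchange_big/=.
  transitivity (\sum_l (k == l)%:R * u l).
    rewrite (bigD1 k)//= eqxx mul1r big1 ?addr0// => l.
    by rewrite eq_sym => /negPf ->; rewrite mul0r.
  apply: eq_bigr => l _; have /(congr1 (@ratr R)) := hE k l.
  rewrite ratr_sum ratr_nat => <-; rewrite mulr_suml.
  by apply: eq_bigr => i _; rewrite ratr_Mint -mulrA.
- move=> rAb; have AB : char_poly A = char_poly B.
    by apply: (irreducible_dvdp_eqp irrB) rB rAb;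
      rewrite ?char_poly_monic// !size_char_poly.
  have BA : B *m A = 1%:M.
    apply/matrixP => k l; rewrite !mxE; move: l; apply: (rat_free_eq b_free).
    transitivity (b k); last first.
      rewrite (bigD1 k)//= eqxx rmorph1 mul1r big1 ?addr0// => l.
      by rewrite eq_sym => /negPf ->; rewrite rmorph0 mul0r.
    rewrite -[RHS](mulVKf rho_neq0) BE mulr_sumr.
    under [RHS]eq_bigr do rewrite mulrCA AE mulr_sumr.
    rewrite exchange_big/=; apply: eq_bigr => l _; rewrite ratr_sum mulr_suml.
    by apply: eq_bigr => j _; rewrite rmorphM -mulrA.
  (* A rational root would have to be [rho] itself, and [0 < rho < 1] rules out 1 and -1. *)
  apply: (char_poly_inv_even BA AB); apply: (irreducible_horner_neq0 irrA rA).
    by rewrite rmorph1 lt_eqF//; case/andP: rho01.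
  by rewrite rmorphN rmorph1 gt_eqF// (lt_trans _ rho_gt0)// oppr_lt0 ltr01.
Qed.

(** The minimal polynomial of [rho], of degree [n], divides the characteristic polynomial of [M], of
    degree [N]. *)
Lemma basis_card_le : (n <= N)%N.
Proof.
have [p [irr_p rp sp _]] := scaling_min_poly.
rewrite -ltnS -sp -(size_char_poly M); apply: dvdp_leq => //.
by apply: irreducible_root_dvdp irr_p rp _; rewrite -rootM root_incidence_scaling.
Qed.

Lemma drift_eq0_card : (forall l, S l = 0) -> (2 * n <= N)%N.
Proof.
move=> S0; have [p [irr_p rp sp [driftP _]]] := scaling_min_poly.
have [B BE] := exists_B.
have [irrB rB] := rat_basis_char_poly b_free basis_gt0 (basis_mem rho_Qbeta) BE.
(* Otherwise the irreducible [p] divides a polynomial of its own size, so [rho^-1] is a root of [p]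
   and the drift is nonzero. *)
have co : coprimep p (char_poly B).
  rewrite (irreducible_poly_coprime _ irr_p); apply/negP => pB.
  have pB' : p %= char_poly B.
    by rewrite -dvdp_size_eqp// sp size_char_poly.
  have /driftP.2[l] : root (map_poly ratr p) rho^-1.
    by move: pB'; rewrite -(eqp_map (@ratr R)) => /eqp_root ->.
  by rewrite S0 eqxx.
have : p * char_poly B %| char_poly M.
  rewrite Gauss_dvdp// (irreducible_root_dvdp irr_p rp) -?rootM ?root_incidence_scaling//.
  by rewrite (irreducible_root_dvdp irrB rB) -?rootM ?root_incidence_expansion.
move=> /(dvdp_leq chi_neq0); rewrite size_mul ?irredp_neq0// sp !size_char_poly.
by rewrite addSn addnS /= ltnS addnn mul2n.
Qed.

End RenormalizationArithmetic.

(** * Interval exchange maps and Lebesgue measure *)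

Section ExchangeMap.
Context {R : realType} {N : nat} (E : iet R N).
Implicit Types (i j : 'I_N) (x y : R).

Let sum_len_sub (P Q : pred 'I_N) : (forall l, P l -> Q l) ->
  \sum_(l | P l) len E l <= \sum_(l | Q l) len E l.
Proof.
move=> PQ; rewrite big_mkcond [leRHS]big_mkcond; apply: ler_sum => l _.
case: ifP => [/PQ ->//|_]; case: ifP => // _; exact: ltW (len_gt0 _ _).
Qed.

(** The ranking [s] allows one argument for both arrangements: the identity ranks the intervals
    before the exchange, [iet_perm E] after it. *)
Lemma sum_len_before (s : 'I_N -> nat) i j : (s i < s j)%N ->
  \sum_(l < N | (s l < s i)%N) len E l + len E i <= \sum_(l < N | (s l < s j)%N) len E l.
Proof.
move=> sij; rewrite [leRHS](bigD1 i)//= [leLHS]addrC lerD2l.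
apply: sum_len_sub => l sli; rewrite (ltn_trans sli sij)/=.
by apply: contraTneq sli => ->; rewrite ltnn.
Qed.

Lemma sum_len_bound (s : 'I_N -> nat) i :
  0 <= \sum_(l < N | (s l < s i)%N) len E l /\
  \sum_(l < N | (s l < s i)%N) len E l + len E i <= 1.
Proof.
split; first by apply: sumr_ge0 => l _; rewrite ltW// len_gt0.
rewrite -(len_sum1 E) [leRHS](bigD1 i)//= [leLHS]addrC lerD2l.
apply: sum_len_sub => l sli.
by apply: contraTneq sli => ->; rewrite ltnn.
Qed.

Lemma sum_len_inj (s : 'I_N -> nat) i j x : injective s ->
  \sum_(l < N | (s l < s i)%N) len E l <= x
    < \sum_(l < N | (s l < s i)%N) len E l + len E i ->
  \sum_(l < N | (s l < s j)%N) len E l <= x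
    < \sum_(l < N | (s l < s j)%N) len E l + len E j ->
  i = j.
Proof.
move=> s_inj /andP[ix xi] /andP[jx xj]; apply: s_inj.
case: (ltngtP (s i) (s j)) => // /sum_len_before le_start.
  by have := lt_le_trans (lt_le_trans xi le_start) jx; rewrite ltxx.
by have := lt_le_trans (lt_le_trans xj le_start) ix; rewrite ltxx.
Qed.

Lemma in_Omega i x : (x \in Omega E i) = (endpoint E i <= x < endpoint E i + len E i).
Proof. by rewrite in_itv. Qed.

Lemma Omega_inj i j x : x \in Omega E i -> x \in Omega E j -> i = j.
Proof.
by rewrite !in_Omega; apply: (@sum_len_inj (@nat_of_ord N)); exact: val_inj.
Qed.

Lemma Omega_sub01 i x : x \in Omega E i -> 0 <= x < 1.
Proof.
have [e0 e1] := sum_len_bound (@nat_of_ord N) i.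
rewrite in_Omega => /andP[ex xe].
by rewrite (le_trans e0)//= (lt_le_trans xe).
Qed.

Lemma Omega_cover x : 0 <= x < 1 -> exists i, x \in Omega E i.
Proof.
case/andP=> x0 x1; pose e k := \sum_(l < N | (l < k)%N) len E l.
have eN : x < e N by rewrite /e (eq_bigl xpredT) ?len_sum1// => l; rewrite ltn_ord.
(* The interval containing [x] is the one just before the first partial sum that exceeds [x]. *)
have [k ek kmin] := ex_minnP (ex_intro (fun k => x < e k) _ eN).
have kN : (k <= N)%N by exact: kmin.
case: k ek kmin kN => [|k] ek kmin kN.
  by move: ek; rewrite /e big_pred0// ltNge x0.
exists (Ordinal kN); rewrite in_Omega; apply/andP; split.
  by rewrite leNgt; apply/negP => /kmin; rewrite ltnn.
move: ek; rewrite /e (bigD1 (Ordinal kN))//= addrC.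
rewrite (eq_bigl (fun l : 'I_N => (l < k)%N))// => l.
by rewrite ltnS -val_eqE/= [RHS]ltn_neqAle andbC.
Qed.

Lemma iet_mapE i x : x \in Omega E i -> iet_map E x = x + translation E i.
Proof.
rewrite /iet_map => xi; case: pickP => [j xj|/(_ i)]; last by rewrite xi.
by rewrite (Omega_inj xi xj).
Qed.

Let image_start i := \sum_(j < N | (iet_perm E j < iet_perm E i)%N) len E j.

Lemma iet_map_image i x : x \in Omega E i ->
  image_start i <= iet_map E x < image_start i + len E i.
Proof.
move=> xi; rewrite (iet_mapE xi) /translation -/(image_start i).
move: xi; rewrite in_Omega => /andP[ex xe].
by rewrite addrCA lerDl subr_ge0 ex/= ltrD2l ltrBlDl.
Qed.

Lemma iet_map01 x : 0 <= x < 1 -> 0 <= iet_map E x < 1.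
Proof.
case/Omega_cover=> i /iet_map_image/andP[ix xi].
have [s0 s1] := sum_len_bound (fun j => iet_perm E j) i.
by rewrite (le_trans s0)//= (lt_le_trans xi).
Qed.

Lemma iter_iet_map01 k x : 0 <= x < 1 -> 0 <= iter k (iet_map E) x < 1.
Proof. by move=> x01; elim: k => //= k; exact: iet_map01. Qed.

Lemma iet_map_inj x y : 0 <= x < 1 -> 0 <= y < 1 -> iet_map E x = iet_map E y -> x = y.
Proof.
move=> /Omega_cover[i xi] /Omega_cover[j yj] Exy.
have ij : i = j.
  apply: (@sum_len_inj (fun l => iet_perm E l) i j (iet_map E x)).
  - by move=> l l' /val_inj/perm_inj.
  - exact: iet_map_image.
  - by rewrite Exy; exact: iet_map_image.
by move: Exy; rewrite (iet_mapE xi) (iet_mapE yj) ij => /addIr.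
Qed.

Lemma iter_iet_map_inj k x y : 0 <= x < 1 -> 0 <= y < 1 ->
  iter k (iet_map E) x = iter k (iet_map E) y -> x = y.
Proof.
move=> x01 y01; elim: k => //= k IHk /iet_map_inj kxy.
by apply: IHk; apply: kxy; exact: iter_iet_map01.
Qed.

(** If the first interval did not move, no interval would precede it after the exchange, so the
    permutation would fix the first position, against irreducibility at [k = 1]. *)
Lemma translation_neq0 : (2 <= N)%N -> exists i, translation E i != 0.
Proof.
move=> N2; pose i0 := Ordinal (ltnW N2); exists i0; apply/negP => /eqP.
rewrite /translation [endpoint _ _]big_pred0// subr0 => s0.
have p0 : iet_perm E i0 = i0.
  apply/val_inj; rewrite /=; apply/eqP; rewrite -leqn0 leqNgt; apply/negP => p_gt0.
  pose j := ((iet_perm E)^-1)%g i0.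
  have : 0 < \sum_(j < N | (iet_perm E j < iet_perm E i0)%N) len E j.
    rewrite (bigD1 j)/=; last by rewrite permKV.
    by rewrite ltr_pwDl ?len_gt0// sumr_ge0// => l _; rewrite ltW// len_gt0.
  by rewrite s0 ltxx.
have /(@iet_irreducible _ _ E) : (0 < 1 <= N)%N by exact: ltnW N2.
have set1E : [set i : 'I_N | (i < 1)%N]%SET = [set i0]%SET.
  by apply/setP => i; rewrite !inE ltnS leqn0.
rewrite !set1E finset.imset_set1 p0 => /(_ erefl) N1.
by have := N2; rewrite -[X in (_ <= X)%N]N1.
Qed.

End ExchangeMap.

Section FiniteAdditivity.
Context d (T : measurableType d) (R : realType) (mu : {measure set T -> \bar R}).
Context (I : finType) (F : I -> set T).
Hypothesis mF : forall i, measurable (F i).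
Hypothesis dF : forall i j x, F i x -> F j x -> i = j.
Local Open Scope ereal_scope.

Lemma measurable_bigcup_finType (P : pred I) : measurable (\bigcup_(i in [set` P]) F i).
Proof. by apply: fin_bigcup_measurable => // i _; exact: mF. Qed.

Lemma measure_bigcup_finType (P : pred I) :
  mu (\bigcup_(i in [set` P]) F i) = \sum_(i | P i) mu (F i).
Proof.
have seqE (s : seq I) : uniq s ->
    mu (\bigcup_(i in [set` s]) F i) = \sum_(i <- s) mu (F i).
  elim: s => [|i s IHs] /=; first by rewrite big_nil set_nil bigcup_set0 measure0.
  move=> /andP[nis us]; have -> : [set` i :: s] = i |` [set` s].
    apply/seteqP; split=> j /=; rewrite in_cons; first by case/predU1P; [left|right].
    by case=> [->|->]; rewrite ?eqxx ?orbT.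
  rewrite bigcup_setU1 measureU//.
  - by rewrite big_cons; congr (_ + _); exact: IHs.
  - by apply: fin_bigcup_measurable => // j _; exact: mF.
  - apply/seteqP; split=> // x [Fi [j /= js Fj]].
    by move: nis; rewrite (dF Fi Fj) js.
rewrite -big_enum -seqE ?enum_uniq//; congr (mu _).
by apply/seteqP; split=> x [i /= Pi Fi]; exists i => //=; move: Pi; rewrite mem_enum.
Qed.

End FiniteAdditivity.

(** * Translation invariance of Lebesgue measure *)

Section LebesgueShift.
Context {R : realType}.
Local Notation mu := (@lebesgue_measure R).

Lemma measurable_shift (t : R) :
  measurable_fun [set: measurableTypeR R] (fun x : R => x + t : measurableTypeR R).
Proof. exact: measurable_funD. Qed.

(** The pushforward by a translation gives every half-open interval its length, and this
    characterizes Lebesgue measure. *)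
Lemma lebesgue_measure_shift (t : R) (A : set (measurableTypeR R)) : measurable A ->
  mu ((fun x => x + t) @^-1` A) = mu A.
Proof.
move=> mA.
apply/esym; rewrite -[RHS]/(pushforward mu (fun x : R => x + t : measurableTypeR R) A).
apply: lebesgue_measure_unique => //; first exact: measurable_shift.
move=> mf _ [[x y]] _ <-.
rewrite /= /pushforward.
have -> : (fun z => z + t) @^-1` [set` `]x, y]] = [set` `]x - t, y - t]] :> set R.
  by apply/seteqP; split=> z /=; rewrite !in_itv/= ltrBlDr lerBrDr.
rewrite !lebesgue_measure_itv/= !lte_fin ltrD2r; case: ifP => // _.
by rewrite -!EFinB opprD addrACA subrr addr0.
Qed.

End LebesgueShift.

(** * Invariant measures from forward invariant sets *)

Section InvariantMeasure.
Context {R : realType} {N : nat} (E : iet R N).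
Local Notation mu := (@lebesgue_measure R).
Local Notation T := (measurableTypeR R).
Implicit Types (U A : set T).

Let Om (i : 'I_N) : set T := [set` Omega E i].

Let mOm i : measurable (Om i). Proof. exact: measurable_itv. Qed.

Let m01 : measurable (`[0, 1[%classic : set T). Proof. exact: measurable_itv. Qed.

Lemma measurable_preimage_shift (t : R) A : measurable A ->
  measurable ((fun x : R => x + t) @^-1` A : set T).
Proof. by move=> mA; rewrite -[X in measurable X]setTI; exact: measurable_shift. Qed.

Lemma measurable_iet_preimage A : measurable A -> measurable (iet_map E @^-1` A : set T).
Proof.
move=> mA; have -> : iet_map E @^-1` A =
    (A `\` `[0, 1[%classic) `|`
    \bigcup_(i in [set` xpredT]) (Om i `&` (fun x => x + translation E i) @^-1` A).
  apply/seteqP; split=> x /=.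
    move=> Ax; case: (boolP (0 <= x < 1)) => x01.
      have [i xi] := Omega_cover E x01; right; exists i => //.
      by split => //=; rewrite -(iet_mapE xi).
    left; split; last by rewrite in_itv/=; exact/negP.
    move: Ax; rewrite /iet_map; case: pickP => // i /Omega_sub01.
    by rewrite (negPf x01).
  move=> [[Ax nx]|[i _ [xi]]] /=; last by rewrite (iet_mapE xi).
  rewrite /iet_map; case: pickP => // i /Omega_sub01 x01.
  by case: nx; rewrite /= in_itv.
apply: measurableU; first exact: measurableD.
apply: fin_bigcup_measurable => // i _; apply: measurableI => //.
exact: measurable_preimage_shift.
Qed.

Section ForwardInvariant.
Context (U : set T).
Hypothesis mU : measurable U.
Hypothesis U01 : U `<=` `[0, 1[%classic.
Hypothesis EU : forall x, U x -> U (iet_map E x).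

(* Applied to the complement of [A] as well, this inequality becomes an
   equality, so surjectivity of [iet_map E] on [U] is not needed. *)
Let preimage_le A : measurable A -> (mu (iet_map E @^-1` A `&` U) <= mu (A `&` U))%E.
Proof.
move=> mA; pose sh (t : R) (x : R) := x + t.
(* [F i] is the part of the preimage in the [i]-th interval, and [G i] is its image, a translate of
   equal measure. The [G i] are disjoint because the exchange is injective, and lie in [U] by
   forward invariance. *)
pose F i := Om i `&` U `&` sh (translation E i) @^-1` A.
pose G i := sh (- translation E i) @^-1` (Om i `&` U) `&` A.
have Gx i x : G i x -> exists2 y, (y \in Omega E i) /\ U y & x = iet_map E y.
  move=> [[/= yi Uy] Ax]; exists (sh (- translation E i) x) => //.
  by rewrite (iet_mapE yi) /sh subrK.
have mF i : measurable (F i).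
  by apply: measurableI; [exact: measurableI|exact: measurable_preimage_shift].
have mG i : measurable (G i).
  by apply: measurableI => //; apply: measurable_preimage_shift; exact: measurableI.
have FG i : mu (F i) = mu (G i).
  rewrite -(lebesgue_measure_shift (translation E i) (mG i)); congr (mu _).
  by apply/seteqP; split=> x /=; rewrite /G /F /sh/= addrK.
have -> : iet_map E @^-1` A `&` U = \bigcup_(i in [set` xpredT]) F i.
  apply/seteqP; split=> [x [Ax Ux]|x [i _ [[xi Ux] Ax]]].
    have [i xi] : exists i, x \in Omega E i.
      by apply: Omega_cover; have := U01 Ux; rewrite /= in_itv.
    by exists i => //; split => //=; rewrite /sh -(iet_mapE xi).
  by split => //=; rewrite (iet_mapE xi).
rewrite measure_bigcup_finType//; last first.
  by move=> i j x [[xi _] _] [[xj _] _]; exact: Omega_inj xi xj.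
rewrite (eq_bigr _ (fun i _ => FG i)) -measure_bigcup_finType//; last first.
  move=> i j x /Gx[y [yi Uy] ->] /Gx[z [zj Uz]] Eyz.
  apply: (@Omega_inj _ _ E _ _ y) => //.
  by rewrite (iet_map_inj _ _ Eyz)//; [exact: Omega_sub01 yi|exact: Omega_sub01 zj].
apply: le_measure; rewrite ?inE//.
- exact: measurable_bigcup_finType.
- exact: measurableI.
move=> x [i _ Gix]; split; first by case: Gix.
by have [y [_ Uy] ->] := Gx _ _ Gix; exact: EU.
Qed.

Let muU_fin : (mu U < +oo)%E.
Proof.
apply: (@le_lt_trans _ _ (mu (`[0%R, 1%R[%classic : set T))).
  by apply: le_measure; rewrite ?inE.
by rewrite lebesgue_measure_itv/= lte_fin ltr01 sube0 ltry.
Qed.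

Let mu_split A : measurable A -> (mu (A `&` U) + mu (~` A `&` U) = mu U)%E.
Proof.
move=> mA; rewrite -measureU.
- by rewrite -setIUl setUv setTI.
- exact: measurableI.
- by apply: measurableI => //; exact: measurableC.
- by apply/seteqP; split=> // x [[? _] []].
Qed.

Let mu_fin A : measurable A -> mu (A `&` U) \is a fin_num.
Proof.
move=> mA; rewrite ge0_fin_numE//; apply: le_lt_trans muU_fin.
by apply: le_measure; rewrite ?inE//; exact: measurableI.
Qed.

Let preimage_eq A : measurable A -> mu (iet_map E @^-1` A `&` U) = mu (A `&` U).
Proof.
move=> mA; have mEA := measurable_iet_preimage mA.
apply/eqP; rewrite eq_le preimage_le//=.
have mAC := measurableC mA; have := preimage_le mAC.
rewrite preimage_setC -(@leeD2lE _ (mu (A `&` U)) _ _ (mu_fin mA)) mu_split//.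
rewrite -(mu_split mEA) leeD2rE//; apply: mu_fin; exact: measurableC.
Qed.

Hypothesis muU_gt0 : (0 < mu U)%E.

Lemma invariant_probability_restr : exists2 P : probability T R,
  invariant_probability E P & forall A, P A = (mu (A `&` U) * (fine (mu U))^-1%:E)%E.
Proof.
(* The Dirac mass is the default of [mnormalize] for total mass zero or infinite; both cases are
   excluded below. *)
pose P : probability T R := mnormalize (mrestr mu mU) (dirac (0 : T)).
have PE A : P A = (mu (A `&` U) * (fine (mu U))^-1%:E)%E.
  have muT : mrestr mu mU [set: T] = mu U by congr (mu _); exact: setTI.
  rewrite /P /= /mnormalize; case: ifPn => [/orP[]/eqP/(etrans (esym muT)) U0|_].
  - by move: muU_gt0; rewrite U0 ltxx.
  - by move: muU_fin; rewrite U0 ltxx.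
  - by congr (_ * (fine _)^-1%:E)%E.
exists P => //; split=> [|A mA]; last by rewrite !PE preimage_eq.
rewrite PE setIidr// -[X in (X * _)%E]fineK ?ge0_fin_numE//.
by rewrite -EFinM divff// gt_eqF// fine_gt0// muU_gt0.
Qed.

End ForwardInvariant.

(** Lebesgue measure on [0,1) and its normalized restriction to [U] are both invariant, hence equal.
    They give [U] the masses [mu U] and 1. *)
Lemma uniquely_ergodic_forward_invariant U : uniquely_ergodic E ->
  measurable U -> U `<=` `[0, 1[%classic -> (forall x, U x -> U (iet_map E x)) ->
  (0 < mu U)%E -> mu U = 1%E.
Proof.
move=> [P _ Puniq] mU U01 EU U0.
have mu01 : mu (`[0, 1[%classic : set T) = 1%E.
  by rewrite lebesgue_measure_itv/= lte_fin ltr01 sube0.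
have E01 x : (`[0, 1[%classic : set T) x -> (`[0, 1[%classic : set T) (iet_map E x).
  by rewrite /= !in_itv/=; exact: iet_map01.
have [Q invQ QE] := invariant_probability_restr m01 (@subset_refl _ _) E01
  ltac:(by rewrite mu01).
have [Q' invQ' QE'] := invariant_probability_restr mU U01 EU U0.
have := Puniq _ invQ U mU; rewrite -(Puniq _ invQ' U mU) QE QE' mu01 setIid.
rewrite setIidl// invr1 mule1 => ->.
have Ufin : mu U \is a fin_num.
  rewrite ge0_fin_numE// (@le_lt_trans _ _ (mu (`[0%R, 1%R[%classic : set T)))//.
    by apply: le_measure; rewrite ?inE.
  by rewrite mu01 ltry.
rewrite -[X in (X * _)%E]fineK// -EFinM divff// gt_eqF// fine_gt0// U0/=.
by rewrite -ge0_fin_numE.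
Qed.

End InvariantMeasure.

(** * Towers of the renormalization *)

Section Renormalization.
Context {R : realType} {N : nat} (E : iet R N) (a rho : R).
Context (sigma : 'I_N -> seq 'I_N).
Hypothesis renorm : renormalizable E a rho.
Hypothesis sigma_assoc : associated_substitution E a rho sigma.
Implicit Types (i j : 'I_N) (x y : R) (k : nat).

Let rho_gt0 : 0 < rho. Proof. by case: renorm => /andP[]. Qed.

Let rescale01 x : 0 <= x < 1 -> 0 <= a + rho * x < 1.
Proof.
case: renorm => _ a0 a1 _ /andP[x0 x1]; apply/andP; split.
  by rewrite addr_ge0// mulr_ge0// ltW.
by apply: lt_le_trans a1; rewrite ltrD2l gtr_pMr.
Qed.

Lemma first_return_unique (I : set R) x s t :
  first_return E I x s -> first_return E I x t -> s = t.
Proof.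
move=> [s0 Is ns] [t0 It nt]; case: (ltngtP s t) => // st; exfalso.
  by apply: (nt s) Is; rewrite s0.
by apply: (ns t) It; rewrite t0.
Qed.

Definition tower_shift i k : R :=
  \sum_(l < k) translation E (nth i (sigma i) l).

Lemma iter_iet_map_tower i x k : x \in Omega E i -> (k <= size (sigma i))%N ->
  iter k (iet_map E) (a + rho * x) = a + rho * x + tower_shift i k.
Proof.
move=> /sigma_assoc[_ itinerary]; elim: k => [|k IHk] ki.
  by rewrite /tower_shift big_ord0 addr0.
rewrite iterS (iet_mapE (itinerary _ ki)) IHk ?(ltnW ki)//.
by rewrite [in RHS]/tower_shift big_ord_recr/= -addrA.
Qed.

Lemma iter_iet_map_return i x : x \in Omega E i ->
  iter (size (sigma i)) (iet_map E) (a + rho * x) = a + rho * iet_map E x.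
Proof.
move=> xi; have [_ _ _ /(_ x (Omega_sub01 xi))[t ft <-]] := renorm.
by rewrite (first_return_unique (sigma_assoc xi).1 ft).
Qed.

Lemma endpoint_Omega i : endpoint E i \in Omega E i.
Proof. by rewrite in_Omega lexx ltrDl len_gt0. Qed.

Lemma sum_seq_count (f : 'I_N -> R) (s : seq 'I_N) :
  \sum_(l < size s) f (tnth (in_tuple s) l) = \sum_j f j * (count_mem j s)%:R.
Proof.
rewrite -(big_tuple _ _ (in_tuple s) xpredT f)/=; elim: s => [|i s IHs].
  by rewrite big_nil big1// => j _; rewrite mulr0.
rewrite big_cons IHs [RHS](bigD1 i)//= eqxx natrD mulrDr mulr1 -addrA; congr (_ + _).
rewrite (bigD1 i)//=; congr (_ + _); apply: eq_bigr => j.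
by rewrite eq_sym => /negPf ->.
Qed.

(** Both sides are the displacement of a base point at its first return: summed along its itinerary,
    and read off from the conjugacy with [E]. The left endpoint serves as sample point. *)
Lemma translation_scaling i :
  \sum_j translation E j * (count_mem j (sigma i))%:R = rho * translation E i.
Proof.
rewrite -sum_seq_count; have ei := endpoint_Omega i.
have := iter_iet_map_return ei; rewrite (iter_iet_map_tower ei)//.
rewrite (iet_mapE ei) mulrDr addrA => /addrI <-.
by apply: eq_bigr => l _; rewrite (tnth_nth i).
Qed.

(** * Floors of the towers and their measure *)

Local Notation mu := (@lebesgue_measure R).

Definition floor_index : finType := {i : 'I_N & 'I_(size (sigma i))}.

Definition Floor i k (ki : (k < size (sigma i))%N) : floor_index :=
  Tagged (fun i => 'I_(size (sigma i))) (Ordinal ki).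

Definition floor_letter (p : floor_index) : 'I_N :=
  nth (tag p) (sigma (tag p)) (tagged p).

(** Given as an explicit interval, so that measurability and length are immediate; [tower_floorP]
    supplies the dynamical description. *)
Definition tower_floor (p : floor_index) : set (measurableTypeR R) :=
  let y := a + rho * endpoint E (tag p) + tower_shift (tag p) (tagged p) in
  `[y, y + rho * len E (tag p)[%classic.

Lemma tower_floorP p y : tower_floor p y <->
  exists2 x, x \in Omega E (tag p) & y = iter (tagged p) (iet_map E) (a + rho * x).
Proof.
case: p => i k; rewrite /tower_floor /= in_itv/=; set s := tower_shift i k.
split=> [/andP[ey ye]|[x xi ->]].
  pose x := rho^-1 * (y - s - a).
  have rxE : a + rho * x = y - s by rewrite mulVKf ?gt_eqF// addrC subrK.
  have xi : x \in Omega E i.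
    rewrite in_Omega; apply/andP; split.
      by rewrite -(ler_pM2l rho_gt0) -(lerD2l a) rxE lerBrDr.
    by rewrite -(ltr_pM2l rho_gt0) -(ltrD2l a) rxE ltrBlDr mulrDr addrA [ltRHS]addrAC.
  by exists x => //; rewrite (iter_iet_map_tower xi) ?(ltnW (ltn_ord k))// rxE subrK.
rewrite (iter_iet_map_tower xi) ?(ltnW (ltn_ord k))// -/s.
move: xi; rewrite in_Omega => /andP[ex xe].
rewrite lerD2r lerD2l ler_pM2l// ex/=.
by rewrite [ltRHS]addrAC ltrD2r -addrA -mulrDr ltrD2l ltr_pM2l.
Qed.

Lemma tower_floor_Omega p y : tower_floor p y -> y \in Omega E (floor_letter p).
Proof. by case/tower_floorP=> x xi ->; apply: (sigma_assoc xi).2. Qed.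

Let in_I x : 0 <= x < 1 -> (`[a, a + rho[%classic : set R) (a + rho * x).
Proof.
case/andP=> x0 x1; rewrite /= in_itv/= lerDl mulr_ge0 ?(ltW rho_gt0)//=.
by rewrite ltrD2l gtr_pMr.
Qed.

(** Cancelling [l] iterates by injectivity puts the orbit of the first base point back in the base
    interval at time [k], before its return time. This is what keeps floors of different levels
    disjoint. *)
Let floor_time i k l x y : x \in Omega E i -> 0 <= y < 1 -> (k + l < size (sigma i))%N ->
  iter (k + l) (iet_map E) (a + rho * x) = iter l (iet_map E) (a + rho * y) -> k = 0%N.
Proof.
move=> xi y01 kl; rewrite addnC iterD => /iter_iet_map_inj Exy.
have {Exy} Exy : iter k (iet_map E) (a + rho * x) = a + rho * y.
  by apply: Exy; [apply: iter_iet_map01|]; apply: rescale01 => //; exact: Omega_sub01 xi.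
apply/eqP; rewrite -leqn0 leqNgt; apply/negP => k0.
have [[_ _ ret] _] := sigma_assoc xi; apply: (ret k).
  by rewrite k0/= (leq_ltn_trans (leq_addr l k)).
by rewrite Exy; exact: in_I.
Qed.

Lemma tower_floor_inj p q y : tower_floor p y -> tower_floor q y -> p = q.
Proof.
wlog lepq : p q / (nat_of_ord (tagged q) <= nat_of_ord (tagged p))%N.
  move=> wl py qy; have [pq|/ltnW pq] := leqP (tagged q) (tagged p).
    exact: wl pq py qy.
  by apply/esym; exact: wl pq qy py.
move=> /tower_floorP[x xp ->] /tower_floorP[z zq Exz].
have z01 := Omega_sub01 zq; have x01 := Omega_sub01 xp.
have pq0 : (tagged p - tagged q)%N = 0%N.
  by apply: (floor_time (l := tagged q) xp z01); rewrite subnK// ltn_ord.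
have pq : tagged p = tagged q :> nat.
  by apply/eqP; rewrite eqn_leq lepq -subn_eq0 pq0.
move: Exz; rewrite pq => /iter_iet_map_inj Exz.
have xz : x = z.
  apply: (mulfI (lt0r_neq0 rho_gt0)); apply: (@addrI _ a); apply: Exz;
    exact: rescale01.
case: p q xp zq pq {lepq x01 z01 pq0 Exz} => [i k] [j l] /= xi zj kl.
rewrite xz in xi; have ij := Omega_inj xi zj; subst j.
by congr existT; exact: val_inj.
Qed.

Let mfloor p : measurable (tower_floor p). Proof. exact: measurable_itv. Qed.

Let mu_floor p : mu (tower_floor p) = (rho * len E (tag p))%:E.
Proof.
rewrite lebesgue_measure_itv/= lte_fin ltrDl mulr_gt0 ?len_gt0//.
by rewrite -EFinB addrAC subrr add0r.
Qed.

Let size_gt0 i : (0 < size (sigma i))%N.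
Proof. by have [[]] := sigma_assoc (endpoint_Omega i). Qed.

Let floors_forward y : (\bigcup_(p in [set` xpredT]) tower_floor p) y ->
  (\bigcup_(p in [set` xpredT]) tower_floor p) (iet_map E y).
Proof.
move=> [[i k] _ /tower_floorP[x /= xi ->]]; rewrite -iterS.
(* From a top floor the orbit returns to the base, which consists of the floors of level 0; any
   other floor goes up one level. *)
have := ltn_ord k; rewrite leq_eqVlt => /predU1P[ki|ki].
  rewrite ki (iter_iet_map_return xi).
  have [j Exj] := Omega_cover E (iet_map01 E (Omega_sub01 xi)).
  exists (Floor (size_gt0 j)) => //; apply/tower_floorP.
  by exists (iet_map E x).
exists (Floor ki) => //; apply/tower_floorP.
by exists x.
Qed.

Lemma len_scaling : uniquely_ergodic E -> forall j,
  \sum_i (count_mem j (sigma i))%:R * len E i = rho^-1 * len E j.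
Proof.
move=> ergo.
have cover : mu (\bigcup_(p in [set` xpredT]) tower_floor p) = 1%E.
  apply: (uniquely_ergodic_forward_invariant ergo) => //.
  - exact: measurable_bigcup_finType.
  - by move=> y [p _ /tower_floor_Omega/Omega_sub01]; rewrite /= in_itv.
  - have N0 : (0 < N)%N.
      have [N0|//] := posnP N; have := len_sum1 E; rewrite big1 => [/eqP|i _].
        by rewrite eq_sym oner_eq0.
      by have := ltn_ord i; rewrite [X in (_ < X)%N]N0.
    pose p := Floor (size_gt0 (Ordinal N0)).
    apply: (@lt_le_trans _ _ (mu (tower_floor p))).
      by rewrite mu_floor lte_fin mulr_gt0 ?len_gt0.
    apply: le_measure; rewrite ?inE//; first exact: measurable_bigcup_finType.
    by move=> y py; exists p.
have sum1 : \sum_p rho * len E (tag (p : floor_index)) = 1.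
  apply: (@EFin_inj R); rewrite -cover measure_bigcup_finType//; last first.
    exact: tower_floor_inj.
  by rewrite -sumEFin; apply: eq_bigr => p _; exact/esym/mu_floor.
(* The floors lying in the [j]-th interval have total length [g j], at most the length of that
   interval. Both families sum to 1, so the inequalities are equalities. *)
pose g j := \sum_(p : floor_index | floor_letter p == j) rho * len E (tag p).
have g_le j : g j <= len E j.
  rewrite -lee_fin /g -sumEFin -(eq_bigr _ (fun p _ => mu_floor p)).
  rewrite -measure_bigcup_finType//; last exact: tower_floor_inj.
  have -> : (len E j)%:E = mu [set` Omega E j].
    rewrite lebesgue_measure_itv/= lte_fin ltrDl len_gt0.
    by rewrite -EFinB addrAC subrr add0r.
  apply: le_measure; rewrite ?inE.
  - exact: measurable_bigcup_finType.
  - exact: measurable_itv.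
  - by move=> y [p /= /eqP <-] /tower_floor_Omega.
have gE j : g j = len E j.
  apply/eqP; rewrite eq_sym -subr_eq0; move: j.
  have d0 : \sum_j (len E j - g j) == 0.
    rewrite sumrB len_sum1 -sum1 subr_eq0; apply/eqP.
    by rewrite /g (partition_big floor_letter xpredT).
  move=> j; move: d0; rewrite psumr_eq0 => [/allP/(_ j)|l _]; last by rewrite subr_ge0.
  by rewrite mem_index_enum => /(_ isT).
(* Grouping the floors by tower, tower [i] contributes [rho * len E i] for each occurrence of [j] in
   [sigma i]. *)
move=> j; rewrite -gE /g; apply: (mulfI (lt0r_neq0 rho_gt0)).
rewrite mulVKf ?gt_eqF// mulr_sumr.
rewrite [RHS](eq_bigl (fun p : floor_index =>
  true && (nth (tag p) (sigma (tag p)) (tagged p) == j)))//.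
rewrite -(@sig_big_dep _ _ _ _ (fun i => 'I_(size (sigma i))) xpredT
  (fun i (k : 'I_(size (sigma i))) => nth i (sigma i) k == j)
  (fun i _ => rho * len E i))/=.
apply: eq_bigr => i _; rewrite mulrCA.
have := sum_seq_count (fun l => (l == j)%:R : R) (sigma i).
have -> : \sum_l (l == j)%:R * (count_mem l (sigma i))%:R =
    (count_mem j (sigma i))%:R :> R.
  by rewrite (bigD1 j)//= eqxx mul1r big1 ?addr0// => l /negPf ->; rewrite mul0r.
move=> <-; rewrite mulr_suml [RHS]big_mkcond; apply: eq_bigr => k _.
by rewrite (tnth_nth i); case: ifP; rewrite ?mul1r ?mul0r.
Qed.

End Renormalization.

(** The positive vector [lam] makes [x] an eigenvalue, so maximality gives [x <= beta]. Conversely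
    [beta] is a real eigenvalue, so it has a real left eigenvector and the Perron bound applies. *)
Lemma largest_eigenvalue_expansion {R : realType} {N : nat}
    (sigma : 'I_N -> seq 'I_N) (lam : 'I_N -> R) (x beta : R) (i0 : 'I_N) :
  (forall i, 0 < lam i) ->
  (forall j, \sum_i (count_mem j (sigma i))%:R * lam i = x * lam j) -> 0 < x ->
  largest_eigenvalue (incidence sigma) beta -> beta = x.
Proof.
move=> lam_gt0 lamE x0 [beta_eig beta_max].
pose M : 'M[R]_N := map_mx intr (incidence sigma).
have ME j i : M j i = (count_mem j (sigma i))%:R by rewrite !mxE pmulrn.
have x_eig : eigenvalue M x.
  rewrite eigenvalue_root_char; apply/root_char_poly_right; exists lam => [|j].
    by exists i0; rewrite gt_eqF.
  by rewrite -lamE; apply: eq_bigr => i _; rewrite ME.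
have x_le : x <= beta.
  have := beta_max (real_complex R x).
  have -> : (map_mx intr (incidence sigma) : 'M[complex R]_N) = map_mx (real_complex R) M.
    by apply/matrixP => i j; rewrite !mxE/= rmorph_int.
  rewrite eigenvalue_map => /(_ x_eig).
  by rewrite /= expr0n addr0 sqrtr_sqr (ger0_norm (ltW x0)).
apply/eqP; rewrite eq_le x_le andbT.
move: beta_eig; rewrite eigenvalue_root_char => /root_char_poly_left[w [k wk] wE].
rewrite -[beta]ger0_norm ?(le_trans (ltW x0))//.
apply: (@perron_left_norm_le _ _ sigma _ (fun j i => erefl)
  _ _ lam_gt0 lamE _ w k) => // i.
by rewrite -wE; apply: eq_bigr => j _; rewrite -ME.
Qed.

Theorem theorem1 (R : realType) (N : nat) (E : iet R N) (a rho beta : R)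
    (sigma : 'I_N -> seq 'I_N)
    (hN : (2 <= N)%N)
    (hergo : uniquely_ergodic E)
    (hrenorm : renormalizable E a rho)
    (hsigma : associated_substitution E a rho sigma)
    (hprim : primitive_substitution sigma)
    (hbeta : largest_eigenvalue (incidence sigma) beta) :
  [/\ beta = rho^-1,
      is_unit_of (int_adjoin beta) rho,
      forall i, rat_adjoin [set rho] (len E i) &
      forall (n : nat) (b : 'I_n -> R), is_Zbasis (iet_module E) b ->
        [/\ rat_degree (rat_adjoin (range (len E))) n,
            algebraic_degree rho n,
            drift E b != 0 -> ~~ odd n /\ (n <= N)%N &
            drift E b = 0 -> (2 * n <= N)%N]].
Proof.
have [rho01 _ _ _] := hrenorm; have [rho_gt0 _] := andP rho01.
have lamE := len_scaling hrenorm hsigma hergo.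
have tauE := translation_scaling hrenorm hsigma.
have [i0 tau0] := translation_neq0 E hN.
have betaE : beta = rho^-1.
  by apply: (largest_eigenvalue_expansion i0 (len_gt0 E) lamE _ hbeta); rewrite invr_gt0.
have lenF (F : divringClosed R) : rho \in F -> forall i, len E i \in F.
  exact: (len_mem hprim (len_gt0 E) (len_sum1 E) lamE).
split=> //.
- split; first by rewrite betaE; exact: (scaling_adjoin tauE tau0 rho01).
  exists beta; first by exists 'X; rewrite map_polyX hornerX.
  by rewrite betaE mulfV ?gt_eqF.
- move=> i F Fdiv rF.
  pose F' : divringClosed R := HB.pack F (GRing.isDivringClosed.Build _ F Fdiv).
  by apply: (lenF F'); exact: rF.
move=> n b [bM bZfree bspan]; have bfree := int_free_rat_free bZfree.
have lenM i : iet_module E (len E i).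
  exists (fun j => (j == i)%:R); rewrite (bigD1 i)//= eqxx mul1r big1 ?addr0// => j.
  by move=> /negPf ->; rewrite mul0r.
have tauM i : iet_module E (translation E i).
  (* Interval [j] counts +1 if it precedes [i] after the exchange and -1 if it precedes [i]
     before. *)
  exists (fun j => (iet_perm E j < iet_perm E i)%N%:R - (j < i)%N%:R).
  rewrite /translation /endpoint big_mkcond [X in _ - X]big_mkcond -sumrB.
  apply: eq_bigr => j _; rewrite intrD mulrDl intrN mulNr; congr (_ - _);
  by case: ifP; rewrite ?mul1r ?mul0r.
have /choice[m bE] := bM.
have /choice[L lamb] : forall i, exists l : 'I_n -> int, len E i = \sum_k (l k)%:~R * b k.
  by move=> i; apply: bspan.
pose v i k := Zcoord b (translation E i) 0 k.
have taub i : translation E i = \sum_k (v i k)%:~R * b k.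
  have [l lE] := bspan _ (tauM i).
  (* Coordinates exist because [b] spans the module, so [Zcoord] does not fall back on its default
     0. *)
  have : exists w, [set w : 'rV[int]_n | translation E i = \sum_k (w 0 k)%:~R * b k] w.
    by exists (\row_k l k); rewrite /= lE; apply: eq_bigr => k _; rewrite mxE.
  exact: xgetPex.
have driftE l : drift E b 0 l = \sum_i len E i * (v i l)%:~R.
  by rewrite /drift summxE; apply: eq_bigr => i _; rewrite !mxE.
have [p [irr_p rp sp [driftP evenP]]] :=
  scaling_min_poly hprim (len_gt0 E) (len_sum1 E) lamE tauE tau0 rho01 bfree bE lamb taub.
split.
- have bF (F : divringClosed R) : rho \in F -> forall k, b k \in F.
    exact: (basis_mem hprim (len_gt0 E) (len_sum1 E) lamE bE).
  exists b; split=> // [k F Fdiv lenFk|x xlen].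
    pose F' : divringClosed R := HB.pack F (GRing.isDivringClosed.Build _ F Fdiv).
    rewrite bE; apply: (@rpred_sum _ F') => i _; apply: (@rpredM _ F').
      exact: (@rpred_int _ F').
    by apply: lenFk; exists i.
  have p_neq0 := irredp_neq0 irr_p.
  apply: (scaling_field_span (len_gt0 E) (len_sum1 E) lamE i0 lamb).
  (* The polynomials in [rho] form a field containing the lengths, hence the field generated by
     them; each of its elements is a rational combination of [b]. *)
  have Fdiv := rat_horner_divring p_neq0 rp.
  pose F : divringClosed R :=
    HB.pack (rat_horner rho) (GRing.isDivringClosed.Build _ _ Fdiv).
  by apply: (xlen _ Fdiv) => _ [i _ <-]; apply: (lenF F); exact: rat_horner_id.
- by exists p.
- move=> d0; split.
    apply: evenP; apply/driftP; have /rV0Pn[l dl] := d0; exists l.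
    by rewrite -driftE.
  exact: (basis_card_le hprim (len_gt0 E) (len_sum1 E) lamE tauE tau0 rho01
    bfree bE lamb taub).
- move=> d0.
  apply: (drift_eq0_card hprim (len_gt0 E) (len_sum1 E) lamE tauE tau0 rho01
    bfree bE lamb taub).
  by move=> l; rewrite -driftE d0 mxE.
Qed.
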